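(* Let $m_X,m_Y,\Omega_X,\Omega_Y,\alpha>0$ and for $\bar\gamma>0$ let $\overline{C}(\bar\gamma)=\mathbb{E}[\log_2(1+\gamma)]$, where $\gamma$ is the instantaneous SNR of the $\alpha$-Beaulieu–Xie shadowed channel with average SNR $\bar\gamma$. Define $$A(\bar\gamma)=\frac{2}{\alpha\ln 2}\left(\ln\!\big(\mathrm{C}_\alpha\bar\gamma^{\alpha/2}\big)+\psi(m_X)+(1-\bar\beta)^{m_Y}\,{}_2F_1^{(1,0,0,0)}(m_X,m_Y;m_X;\bar\beta)\right),$$ where $\psi$ is the digamma function and ${}_2F_1^{(1,0,0,0)}(a,b;c;z)=\frac{\partial}{\partial a}{}_2F_1(a,b;c;z)$. Then $\mathbb{E}[\log_2\gamma]=A(\bar\gamma)$ and $\lim_{\bar\gamma\to\infty}\big(\overline{C}(\bar\gamma)-A(\bar\gamma)\big)=0$.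
   Context: Fix parameters $m_X,m_Y,\Omega_X,\Omega_Y>0$. The Beaulieu–Xie shadowed envelope is a random variable $\bar R>0$ with density $$f_{\bar R}(r)=\frac{2r^{2m_X-1}}{\Gamma(m_X)}\left(\frac{m_Y\Omega_X}{m_Y\Omega_X+m_X\Omega_Y}\right)^{m_Y}\left(\frac{m_X}{\Omega_X}\right)^{m_X}{}_1F_1\!\left(m_Y;m_X;\frac{m_X^2\Omega_Y r^2}{\Omega_X(m_Y\Omega_X+m_X\Omega_Y)}\right)e^{-\frac{m_X}{\Omega_X}r^2},\quad r>0.$$ Set $\bar\beta=\frac{m_X\Omega_Y}{m_Y\Omega_X+m_X\Omega_Y}$. For $\alpha>0$ put $$\mathrm{C}_\alpha=\left[\frac{\Gamma(m_X)}{\Gamma(m_X+\frac{2}{\alpha})\,{}_2F_1\!\left(m_Y,-\frac{2}{\alpha};m_X;-\frac{m_X\Omega_Y}{m_Y\Omega_X}\right)}\right]^{\alpha/2}.$$ For $\bar\gamma>0$, the instantaneous SNR of the $\alpha$-Beaulieu–Xie shadowed channel with average SNR $\bar\gamma$ is the random variable $\gamma=\bar\gamma\,\big(\mathrm{C}_\alpha m_X\bar R^2/\Omega_X\big)^{2/\alpha}$. Here ${}_1F_1(a;b;z)=\sum_{n\ge0}\frac{(a)_n}{(b)_n}\frac{z^n}{n!}$, ${}_2F_1$ is the Gauss hypergeometric function. *)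

(* Defs.v *)
From HB Require Import structures.
From mathcomp Require Import all_boot all_order all_algebra.
From mathcomp Require Import all_classical all_reals all_analysis.
Set Implicit Arguments. Unset Strict Implicit. Unset Printing Implicit Defensive.
Import Order.TTheory GRing.Theory Num.Theory.
Import numFieldNormedType.Exports.
Local Open Scope classical_set_scope.
Local Open Scope ring_scope.

Section BXDefs.
Variable R : realType.

Definition posR : set R := `]0, +oo[.

Definition pochhammer (a : R) (n : nat) : R := \prod_(i < n) (a + i%:R).

Definition hyp1F1 (a b z : R) : R :=
  limn (series (fun n : nat => pochhammer a n / pochhammer b n * z ^+ n / (n`!)%:R)).

Definition hyp2F1_series (a b c z : R) : R :=
  limn (series (fun n : nat => pochhammer a n * pochhammer b n / pochhammer c n
                      * z ^+ n / (n`!)%:R)).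

(* Gauss hypergeometric function 2F1(a,b;c;z) for real z < 1 (principal branch):
   the series for |z| < 1, and for z <= -1 its analytic continuation given by
   the Pfaff transformation 2F1(a,b;c;z) = (1-z)^(-a) 2F1(a,c-b;c;z/(z-1)).
   (Values for z >= 1 are irrelevant and not meaningful.) *)
Definition hyp2F1 (a b c z : R) : R :=
  if `|z| < 1 then hyp2F1_series a b c z
  else (1 - z) `^ (- a) * hyp2F1_series a (c - b) c (z / (z - 1)).

Definition hyp2F1_da (a b c z : R) : R :=
  derive1 (fun a' => hyp2F1 a' b c z) a.

Definition Gamma (x : R) : R :=
  fine (\int[lebesgue_measure]_(t in posR) (t `^ (x - 1) * expR (- t))%:E)%E.

Definition digamma (x : R) : R := derive1 Gamma x / Gamma x.

Definition log2 (x : R) : R := ln x / ln 2.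

Variables (mX mY OX OY alpha : R).

Definition BX_pdf (r : R) : R :=
  2 * r `^ (2 * mX - 1) / Gamma mX
  * (mY * OX / (mY * OX + mX * OY)) `^ mY * (mX / OX) `^ mX
  * hyp1F1 mY mX (mX ^+ 2 * OY * r ^+ 2 / (OX * (mY * OX + mX * OY)))
  * expR (- (mX / OX * r ^+ 2)).

Definition betabar : R := mX * OY / (mY * OX + mX * OY).

Definition C_alpha : R :=
  (Gamma mX / (Gamma (mX + 2 / alpha)
               * hyp2F1 mY (- (2 / alpha)) mX (- (mX * OY / (mY * OX)))))
  `^ (alpha / 2).

Definition snr (gbar r : R) : R :=
  gbar * (C_alpha * mX * r ^+ 2 / OX) `^ (2 / alpha).

Definition E_log2_snr (gbar : R) : \bar R :=
  (\int[lebesgue_measure]_(r in posR) (log2 (snr gbar r) * BX_pdf r)%:E)%E.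

Definition ergodic_capacity (gbar : R) : \bar R :=
  (\int[lebesgue_measure]_(r in posR) (log2 (1 + snr gbar r) * BX_pdf r)%:E)%E.

Definition A_approx (gbar : R) : R :=
  2 / (alpha * ln 2) *
  (ln (C_alpha * gbar `^ (alpha / 2)) + digamma mX
   + (1 - betabar) `^ mY * hyp2F1_da mX mY mX betabar).

End BXDefs.

(* Main.v *)
Require Import Defs.
From HB Require Import structures.
From mathcomp Require Import all_boot all_order all_algebra.
From mathcomp Require Import all_classical all_reals all_analysis.
From mathcomp Require Import measurable_realfun ring lra zify.
Import Order.TTheory GRing.Theory Num.Theory.
Import numFieldNormedType.Exports.
Local Open Scope classical_set_scope.
Local Open Scope ring_scope.

(** In the variable t = mX r^2 / OX the envelope has density
    (1-b)^mY / Gamma(mX) * t^(mX-1) e^(-t) 1F1(mY;mX;bt), with b = betabar, and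
    ln snr is affine in ln t. Integrating the series termwise gives
    int t^(p-1) e^(-t) 1F1(mY;mX;bt) dt = Gamma(p) 2F1(p,mY;mX;b), so the mean
    of ln t is read off from the derivative of this identity in p at p = mX: no
    series has to be differentiated term by term, only integrals of t^(p-1).
    The capacity gap is the mean of log2(1 + 1/snr), which is O(gbar^(-d)) for
    small d > 0 because ln(1+x) <= x^d/d and a small negative moment of t is finite.
    The constant C_alpha is positive since Kummer's transformation
    1F1(-s;a;-x) = e^(-x) 1F1(a+s;a;x) makes the series 2F1(mY,-s;mX;-w), w < 1,
    the integral of a positive function; for w >= 1 the Pfaff form is a series of
    positive terms. *)

Set Implicit Arguments. Unset Strict Implicit.

Local Notation mu := lebesgue_measure.
Local Notation posR := (@posR _).
Local Notation Int f := ((@lebesgue_measure _).-integrable posR (EFin \o f)).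
Local Notation J f := (Rintegral (@lebesgue_measure _) posR f).

(** * The half-line: continuity and substitution *)

Section HalfLine.
Variable R : realType.
Implicit Types (f g F dF G : R -> R) (t x c p : R).

Lemma posRP t : posR t <-> 0 < t.
Proof. by rewrite /posR /= in_itv /= andbT. Qed.

Lemma measurable_posR : measurable (posR : set R).
Proof. exact: measurable_itv. Qed.

(** Continuity is asked only at positive points, because [powR] and [ln] take default values
    elsewhere; continuous extension to 0 would fail for negative exponents. *)
Definition pos_continuous f := forall t, 0 < t -> {for t, continuous f}.

Lemma pos_continuous_measurable f : pos_continuous f -> measurable_fun posR f.
Proof.
move=> cf; apply: open_continuous_measurable_fun; first exact: interval_open.
by move=> t; rewrite inE => /posRP; exact: cf.
Qed.

Lemma pos_continuous_within f a b : 0 < a -> pos_continuous f -> {within `[a, b], continuous f}.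
Proof.
move=> a0 cf; apply: continuous_in_subspaceT => t.
by rewrite inE /= in_itv /= => /andP[/(lt_le_trans a0) /cf].
Qed.

Lemma is_derive_continuous f t df : is_derive t 1 f df -> {for t, continuous f}.
Proof.
by move=> [df1 _]; apply: differentiable_continuous; exact/derivable1_diffP.
Qed.

Lemma pos_continuousM f g : pos_continuous f -> pos_continuous g ->
  pos_continuous (fun t => f t * g t).
Proof. by move=> cf cg t t0; apply: cvgM; [exact: cf|exact: cg]. Qed.

Lemma pos_continuousD f g : pos_continuous f -> pos_continuous g ->
  pos_continuous (fun t => f t + g t).
Proof. by move=> cf cg t t0; apply: cvgD; [exact: cf|exact: cg]. Qed.

Lemma pos_continuous_powR p : pos_continuous (fun t => t `^ p).
Proof. by move=> t t0; have := is_derive1_powR p t0; apply: is_derive_continuous. Qed.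

Lemma pos_continuous_ln : pos_continuous (@ln R).
Proof. by move=> t; exact: continuous_ln. Qed.

Lemma pos_continuous_cst c : pos_continuous (fun=> c).
Proof. by move=> t t0; exact: cvg_cst. Qed.

Lemma pos_continuous_comp f g : (forall t, 0 < t -> 0 < f t) ->
  pos_continuous f -> pos_continuous g -> pos_continuous (g \o f).
Proof.
by move=> f0 cf cg t t0; apply: continuous_comp; [exact: cf|apply/cg/f0].
Qed.

Lemma pos_continuous_expR c : pos_continuous (fun t => expR (c * t)).
Proof.
move=> t t0; apply: (continuous_comp (f := fun t => c * t)); last exact: continuous_expR.
by apply: cvgM; [exact: cvg_cst|exact: cvg_id].
Qed.

(** Monotone convergence along an exhaustion; it carries results on compact intervals over to the
    half-line. *)
Lemma ge0_cvg_integral_posR (U : nat -> set R) f :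
  \bigcup_n U n = posR -> nondecreasing_seq U -> (forall n, measurable (U n)) ->
  pos_continuous f -> (forall t, 0 < t -> 0 <= f t) ->
  (\int[mu]_(t in U n) (f t)%:E @[n --> \oo] --> \int[mu]_(t in posR) (f t)%:E)%E.
Proof.
move=> UE ndU mU cf f0; have sU n : U n `<=` posR by rewrite -UE; exact: bigcup_sup.
rewrite -UE; apply: ge0_nondecreasing_set_cvg_integral => //.
- move=> i; apply/measurable_EFinP; apply: measurable_funS (pos_continuous_measurable cf) => //.
  exact: measurable_posR.
- by move=> i x /sU/posRP /f0; rewrite lee_fin.
Qed.

Lemma ge0_substitution_posR F dF G :
  (forall x y, 0 < x -> x < y -> F x < F y) ->
  (forall t, 0 < t -> 0 < F t) ->
  (forall t, 0 < t -> is_derive t 1 F (dF t)) ->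
  (forall t, 0 < t -> 0 <= dF t) ->
  pos_continuous dF ->
  (forall x, 0 < x -> exists n, F n.+1%:R^-1 <= x <= F n.+1%:R) ->
  pos_continuous G -> (forall t, 0 < t -> 0 <= G t) ->
  (\int[mu]_(t in posR) (G t)%:E =
   \int[mu]_(t in posR) (G (F t) * dF t)%:E)%E.
Proof.
move=> Finc F0 Fder dF0 cdF Fex cG G0.
have cF : pos_continuous F by move=> t t0; exact: is_derive_continuous (Fder t t0).
have i0 n : 0 < n.+1%:R^-1 :> R by rewrite invr_gt0.
have iN n : n.+1%:R^-1 <= n.+1%:R :> R.
  by apply: (@le_trans _ _ 1); rewrite ?invf_le1 ?ler1n.
have Fle x y : 0 < x -> x <= y -> F x <= F y.
  move=> x0; rewrite le_eqVlt => /predU1P[->//|xy]; exact/ltW/Finc.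
pose U n : set R := `[n.+1%:R^-1, n.+1%:R]%classic.
pose V n : set R := `[F n.+1%:R^-1, F n.+1%:R]%classic.
have UE : \bigcup_n U n = posR.
  apply/seteqP; split=> [t [n _]|t /posRP t0].
    by rewrite /U /= in_itv /= => /andP[+ _] => /(lt_le_trans (i0 n)) /posRP.
  exists (maxn (Num.truncn t) (Num.truncn t^-1)) => //.
  rewrite /U /= in_itv /=; apply/andP; split.
    rewrite -[leRHS]invrK lef_pV2 ?posrE ?invr_gt0//.
    apply/ltW/(lt_le_trans (truncnS_gt t^-1)).
    by rewrite ler_nat ltnS leq_maxr.
  apply/ltW/(lt_le_trans (truncnS_gt t)).
  by rewrite ler_nat ltnS leq_maxl.
have VE : \bigcup_n V n = posR.
  apply/seteqP; split=> [t [n _]|t /posRP t0].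
    rewrite /V /= in_itv /= => /andP[+ _] => h; apply/posRP.
    exact: lt_le_trans (F0 _ (i0 n)) h.
  have [n nt] := Fex _ t0; exists n => //.
have mono m n : (m <= n)%N -> (n.+1%:R^-1 <= m.+1%:R^-1 :> R) /\ (m.+1%:R <= n.+1%:R :> R).
  by move=> mn; rewrite ler_nat lef_pV2 ?posrE ?ltr0n// ler_nat.
have ndU : nondecreasing_seq U.
  move=> m n mn; rewrite subsetEset; apply: subset_itv; rewrite bnd_simp;
  by have [] := mono _ _ mn.
have ndV : nondecreasing_seq V.
  move=> m n mn; have [h1 h2] := mono _ _ mn.
  by rewrite subsetEset; apply: subset_itv; rewrite bnd_simp; apply: Fle.
have sU n : U n `<=` posR by rewrite -UE; exact: bigcup_sup.
have sV n : V n `<=` posR by rewrite -VE; exact: bigcup_sup.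
have cGF : pos_continuous (fun t => G (F t) * dF t).
  by apply: pos_continuousM => //; exact: (pos_continuous_comp (g := G)).
have step n : (\int[mu]_(t in V n) (G t)%:E = \int[mu]_(t in U n) (G (F t) * dF t)%:E)%E.
  have dE t : 0 < t -> derive1 F t = dF t.
    by move=> t0; rewrite derive1E; have [_ ->] := Fder _ t0.
  (* [derive1 F] and [dF] agree only at positive points, so continuity is transferred through a
     neighbourhood of t inside the half-line. *)
  have cF' : pos_continuous (derive1 F).
    move=> t t0; have H : dF s @[s --> t] --> dF t := cdF _ t0.
    rewrite /prop_for /continuous_at (dE _ t0); apply: cvg_trans H; apply: near_eq_cvg.
    by near=> s; rewrite dE//; near: s; exact: lt_nbhsr.
  rewrite integration_by_substitution_increasing//.
  - apply: eq_integral => t; rewrite inE => /sU/posRP t0 /=.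
    by rewrite -dE//.
  - by move=> x y; rewrite in_itv /= => /andP[nx _] _; apply: Finc; exact: lt_le_trans nx.
  - move=> x; rewrite in_itv /= => /andP[nx _]; apply: cF'; exact: lt_trans nx.
  - apply/cvg_ex; exists (derive1 F n.+1%:R^-1); apply: cvg_at_right_filter; exact: cF'.
  - by apply/cvg_ex; exists (derive1 F n.+1%:R); apply: cvg_at_left_filter; exact: cF'.
  - split.
    + move=> x; rewrite in_itv /= => /andP[nx _].
      by have [] := Fder x (lt_trans (i0 n) nx).
    + apply: cvg_at_right_filter; exact: cF.
    + by apply: cvg_at_left_filter; exact: cF.
  - by apply: pos_continuous_within => //; exact: F0.
have c1 := ge0_cvg_integral_posR VE ndV (fun=> measurable_itv _) cG G0.
have := ge0_cvg_integral_posR UE ndU (fun=> measurable_itv _) cGF.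
move=> /(_ _)/cvg_lim <- //; last first.
  by move=> t t0; rewrite mulr_ge0 ?G0 ?dF0 ?F0.
by move: c1; under eq_fun do rewrite step; move=> /cvg_lim <-.
Unshelve. all: by end_near. Qed.

Lemma ge0_substitution_powR c p G : 0 < c -> 0 < p ->
  pos_continuous G -> (forall t, 0 < t -> 0 <= G t) ->
  (\int[mu]_(t in posR) (G t)%:E =
   \int[mu]_(t in posR) (G (c * t `^ p) * (c * p * t `^ (p - 1)))%:E)%E.
Proof.
move=> c0 p0 cG G0.
apply: (@ge0_substitution_posR (fun t => c * t `^ p)) => //.
- move=> x y x0 xy; rewrite ltr_pM2l//; apply: gt0_ltr_powR => //; rewrite nnegrE ltW//.
  exact: lt_trans xy.
- by move=> t t0; rewrite mulr_gt0// powR_gt0.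
- move=> t t0; rewrite -mulrA; have d := is_derive1_powR p t0.
  by have := is_deriveZ c; exact.
- by move=> t t0; rewrite !mulr_ge0// ?powR_ge0// ltW.
- by apply: pos_continuousM; [exact: pos_continuous_cst|exact: pos_continuous_powR].
(* y is the preimage of x; any n with 1/(n+1) <= y <= n+1 then works, since t^p is increasing. *)
- move=> x x0; pose y := (x / c) `^ p^-1.
  have xc0 : 0 < x / c by rewrite divr_gt0.
  have y0 : 0 < y by rewrite powR_gt0.
  have xE : x = c * y `^ p.
    by rewrite -powRrM mulVf ?gt_eqF// powRr1 ?ltW// mulrC divfK ?gt_eqF.
  exists (maxn (Num.truncn y) (Num.truncn y^-1)); set n := maxn _ _.
  have yn : y <= n.+1%:R.
    by apply/ltW/(lt_le_trans (truncnS_gt y)); rewrite ler_nat ltnS leq_maxl.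
  have ny : n.+1%:R^-1 <= y.
    rewrite -[leRHS]invrK lef_pV2 ?posrE ?invr_gt0//.
    by apply/ltW/(lt_le_trans (truncnS_gt y^-1)); rewrite ler_nat ltnS leq_maxr.
  rewrite xE !ler_pM2l//; apply/andP; split; apply: ge0_ler_powR => //;
    by rewrite ?nnegrE ?invr_ge0 ?ler0n// ltW.
Qed.

(** The positive and negative parts are treated separately: the Jacobian is nonnegative, so it
    passes through [Num.max]. *)
Lemma substitution_powR c p G : 0 < c -> 0 < p -> pos_continuous G ->
  (\int[mu]_(t in posR) (G t)%:E =
   \int[mu]_(t in posR) (G (c * t `^ p) * (c * p * t `^ (p - 1)))%:E)%E.
Proof.
move=> c0 p0 cG; rewrite integralE [RHS]integralE.
have max0 (f : R -> R) : pos_continuous f -> pos_continuous (fun t => Num.max (f t) 0).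
  by move=> cf t t0; apply: continuous_max; [exact: cf|exact: cvg_cst].
have cGN : pos_continuous (fun t => - G t) by move=> t t0; apply: cvgN; exact: cG.
have w0 t : 0 < t -> 0 <= c * p * t `^ (p - 1).
  by move=> t0; rewrite !mulr_ge0// ?powR_ge0// ltW.
congr (_ - _)%E.
- transitivity (\int[mu]_(t in posR) (Num.max (G t) 0)%:E)%E.
    by apply: eq_integral => t _; rewrite funeposE EFin_max.
  rewrite (ge0_substitution_powR c0 p0 (max0 _ cG)); last first.
    by move=> t t0; rewrite le_max lexx orbT.
  apply: eq_integral => t; rewrite inE => /posRP t0.
  by rewrite funeposE -EFin_max maxr_pMl ?mul0r// w0.
- transitivity (\int[mu]_(t in posR) (Num.max (- G t) 0)%:E)%E.
    by apply: eq_integral => t _; rewrite funenegE EFin_max.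
  rewrite (ge0_substitution_powR c0 p0 (max0 _ cGN)); last first.
    by move=> t t0; rewrite le_max lexx orbT.
  apply: eq_integral => t; rewrite inE => /posRP t0.
  by rewrite funenegE -EFinN -EFin_max maxr_pMl ?mul0r ?w0// mulNr.
Qed.

End HalfLine.

(** * Mellin transforms of exponentially decaying functions *)

Section Integrability.
Variable R : realType.
Implicit Types (f g w : R -> R) (t x y c p a C : R).

(** This is ln u < u at u = c t / y, multiplied by y and exponentiated. *)
Lemma powR_le_expR y c t : 0 < y -> 0 < c -> 0 < t ->
  t `^ y <= (y / c) `^ y * expR (c * t).
Proof.
move=> y0 c0 t0; have yc0 : 0 < y / c by rewrite divr_gt0.
rewrite /powR !gt_eqF// -expRD ler_expR -lerBlDl -mulrBr -ln_div ?posrE//.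
have /ltW := ln_sublinear (divr_gt0 t0 yc0).
rewrite -(ler_pM2l y0) => /le_trans; apply.
by rewrite le_eqVlt; apply/orP; left; apply/eqP; field; rewrite !gt_eqF.
Qed.

(** From ln v < v at v = t^d when ln t >= 0, and at v = t^(-d) otherwise. It trades a logarithm for
    a small shift of the exponent. *)
Lemma ln_powR_bound d t : 0 < d -> 0 < t -> `|ln t| <= (t `^ d + t `^ (- d)) / d.
Proof.
move=> d0 t0.
have H e : ln t * e <= t `^ e.
  rewrite mulrC -ln_powR; apply/ltW/ln_sublinear; exact: powR_gt0.
have p1 := powR_ge0 t d; have p2 := powR_ge0 t (- d).
rewrite ler_pdivlMr//.
have h1 := H d; have h2 := H (- d).
have [l0|l0] := leP 0 (ln t).
  by rewrite ger0_norm//; apply: (le_trans h1); rewrite lerDl.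
by rewrite ltr0_norm// mulNr -mulrN; apply: (le_trans h2); rewrite lerDr.
Qed.

Lemma Int_le f g : measurable_fun posR f ->
  (forall t, 0 < t -> `|f t| <= g t) -> Int g -> Int f.
Proof.
move=> mf fg ig; apply: le_integrable ig => //.
- exact: measurable_posR.
- exact/measurable_EFinP.
move=> t /posRP t0 /=; rewrite lee_fin; apply: (le_trans (fg _ t0)).
exact: ler_norm.
Qed.

Lemma Int_eq f g : (forall t, 0 < t -> f t = g t) -> Int f -> Int g.
Proof.
move=> fg; apply: eq_integrable; first exact: measurable_posR.
by move=> t; rewrite inE => /posRP t0 /=; rewrite fg.
Qed.

Lemma IntZ c f : Int f -> Int (fun t => c * f t).
Proof.
move=> i; rewrite [X in _.-integrable _ X](_ : _ = fun t => (c%:E * (EFin \o f) t)%E)//.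
by apply: integrableZl => //; exact: measurable_posR.
Qed.

Lemma IntD f g : Int f -> Int g -> Int (fun t => f t + g t).
Proof.
move=> i j; rewrite [X in _.-integrable _ X](_ : _ = (EFin \o f) \+ (EFin \o g))%E//.
by apply: integrableD => //; exact: measurable_posR.
Qed.

(* The pullback of 1/(1+s)^2 under s = t^p; it dominates the Gamma integrand near both
   ends of the half-line. *)
Lemma Int_inv_sqr p : 0 < p -> Int (fun t => (1 + t `^ p) ^- 2 * (p * t `^ (p - 1))).
Proof.
move=> p0; pose G t := (1 + t) ^- 2.
have dG t : 0 <= t -> is_derive t 1 (fun t : R => - (1 + t)^-1) (G t).
  move=> t0; have n0 : 1 + t != 0 by rewrite gt_eqF// ltr_pwDl.
  have h : is_derive t 1 ((cst 1 : R -> R) + id) (0 + 1) by exact: is_deriveD.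
  rewrite add0r in h.
  have := is_deriveN (is_deriveV n0 h).
  move=> /is_derive_eq; apply; rewrite /G.
  by rewrite scaleNr opprK [_ *: _]mulr1.
have cGt t : 0 <= t -> {for t, continuous G}.
  move=> t0; have n0 : 1 + t != 0 by rewrite gt_eqF// ltr_pwDl.
  apply: cvgV; first by rewrite expf_neq0.
  apply: (@cvg_comp _ _ _ (fun t => 1 + t) (fun u => u ^+ 2)); last exact: exprn_continuous.
  by apply: cvgD; [exact: cvg_cst|exact: cvg_id].
have cG0 : {within `[0, +oo[, continuous G}.
  by apply: continuous_in_subspaceT => t; rewrite inE /= in_itv /= andbT; exact: cGt.
have cG : pos_continuous G by move=> t /ltW; exact: cGt.
have G0 t : 0 < t -> 0 <= G t by move=> t0; rewrite invr_ge0 exprn_ge0// addr_ge0// ltW.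
(* The antiderivative -1/(1+t) gives this integral the value 1. *)
have IG : (\int[mu]_(t in posR) (G t)%:E < +oo)%E.
  rewrite integral_itv_obnd_cbnd; last first.
    by apply/measurable_EFinP; exact: pos_continuous_measurable cG.
  rewrite (@ge0_continuous_FTC2y _ G (fun t => - (1 + t)^-1) 0 0)//.
  - by rewrite -EFinB ltry.
  - by move=> t t0; rewrite invr_ge0 exprn_ge0// addr_ge0.
  - rewrite -oppr0; apply: cvgN; apply/(gtr0_cvgV0 (f := fun t => 1 + t)).
      by near=> t; rewrite ltr_pwDl//; near: t; exact: nbhs_pinfty_ge.
    by exact: cvg_addrl.
  - by move=> t /ltW t0; have [] := dG t t0.
  - by apply: cvg_at_right_filter; exact: is_derive_continuous (dG 0 (lexx _)).
  - by move=> t; rewrite in_itv /= andbT => /ltW t0; rewrite derive1E; have [_ ->] := dG t t0.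
apply/integrableP; split.
  apply/measurable_EFinP; apply: pos_continuous_measurable; apply: pos_continuousM.
    apply: (pos_continuous_comp (f := fun t => t `^ p) (g := G)) => //;
      last exact: pos_continuous_powR.
    by move=> t t0; exact: powR_gt0.
  by apply: pos_continuousM; [exact: pos_continuous_cst|exact: pos_continuous_powR].
move: IG; rewrite (ge0_substitution_powR ltr01 p0 cG G0) => /(le_lt_trans _); apply.
rewrite le_eqVlt; apply/orP; left; apply/eqP; apply: eq_integral => t.
rewrite inE => /posRP t0 /=; rewrite !mul1r ger0_norm// mulr_ge0//.
  by rewrite G0// powR_gt0.
by rewrite mulr_ge0 ?powR_ge0// ltW.
Unshelve. all: by end_near. Qed.

(** The factor e^(-ct) (1 + t^x)^2 is bounded, so the integrand is at most a constant times the
    function of [Int_inv_sqr]. *)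
Lemma Int_powR_expR x c : 0 < x -> 0 < c -> Int (fun t => t `^ (x - 1) * expR (- (c * t))).
Proof.
move=> x0 c0; have x20 : 0 < 2 * x by rewrite mulr_gt0.
have [K K0 HK] : exists2 K, 0 <= K & forall t, 0 < t -> expR (- (c * t)) * (1 + t `^ x) ^+ 2 <= K.
  (* M bounds e^(-ct) u^2 for u = t^x; with e^(-ct) <= 1 and (1+u)^2 <= 2 + 2 u^2 this yields the
     bound 2 + 2M. *)
  pose M := (2 * x / c) `^ (2 * x); exists (2 + 2 * M).
    by rewrite addr_ge0// mulr_ge0// powR_ge0.
  move=> t t0; have := powR_le_expR x20 c0 t0; rewrite -/M.
  have -> : t `^ (2 * x) = (t `^ x) ^+ 2 by rewrite mulrC powRrM powR_mulrn// powR_ge0.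
  set u := t `^ x; rewrite -ler_pdivrMr ?expR_gt0// -expRN mulrC => h.
  have e1 : expR (- (c * t)) <= 1 by rewrite expR_le1 oppr_le0 mulr_ge0// ltW.
  have e0 := expR_ge0 (- (c * t)).
  apply: (@le_trans _ _ (expR (- (c * t)) * (2 + 2 * u ^+ 2))).
    apply: ler_wpM2l => //; rewrite -subr_ge0.
    have -> : 2 + 2 * u ^+ 2 - (1 + u) ^+ 2 = (1 - u) ^+ 2 by ring.
    exact: sqr_ge0.
  rewrite mulrDr lerD//; first by rewrite ler_piMl.
  by rewrite mulrCA; apply: ler_wpM2l.
apply: (@Int_le _ (fun t => K / x * ((1 + t `^ x) ^- 2 * (x * t `^ (x - 1))))).
- apply: pos_continuous_measurable; apply: pos_continuousM; first exact: pos_continuous_powR.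
  by under eq_fun do rewrite -mulNr; exact: pos_continuous_expR.
- move=> t t0; rewrite ger0_norm ?mulr_ge0 ?powR_ge0 ?expR_ge0//.
  have u0 : 0 < 1 + t `^ x by rewrite ltr_pwDl// powR_ge0.
  have -> : K / x * ((1 + t `^ x) ^- 2 * (x * t `^ (x - 1))) =
    t `^ (x - 1) * (K / (1 + t `^ x) ^+ 2).
    by field; rewrite !gt_eqF.
  apply: ler_wpM2l; first exact: powR_ge0.
  by rewrite ler_pdivlMr ?exprn_gt0// HK.
by apply: IntZ; exact: Int_inv_sqr.
Qed.

End Integrability.

(** * Differentiating a Mellin transform in its exponent *)

Section MellinDerivative.
Variable R : realType.
Implicit Types (f g w : R -> R) (t x y c p a C : R).

Lemma measurable_mellin x w : measurable_fun posR w ->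
  measurable_fun posR (fun t => t `^ (x - 1) * w t).
Proof. by move=> mw; apply: measurable_funM => //; apply: pos_continuous_measurable;
  exact: pos_continuous_powR. Qed.

Lemma measurable_mellin_ln x w : measurable_fun posR w ->
  measurable_fun posR (fun t => t `^ (x - 1) * ln t * w t).
Proof.
move=> mw; apply: measurable_funM => //; apply: pos_continuous_measurable.
by apply: pos_continuousM; [exact: pos_continuous_powR|exact: pos_continuous_ln].
Qed.

(** Powers of t are monotone in the exponent, in a direction depending on whether t <= 1, so one of
    the two end exponents always dominates. *)
Lemma powR_between y1 y y2 t : 0 < t -> y1 <= y <= y2 -> t `^ y <= t `^ y1 + t `^ y2.
Proof.
move=> t0 /andP[h1 h2]; have [t1|t1] := leP t 1.
  by rewrite (@le_trans _ _ (t `^ y1))// ?lerDl ?powR_ge0//; apply: ger_powR => //; rewrite t0.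
by rewrite (@le_trans _ _ (t `^ y2))// ?lerDr ?powR_ge0//; apply: ler_powR => //; exact: ltW.
Qed.

Section ExponentialDecay.
Variables (w : R -> R) (c C : R).
Hypothesis c0 : 0 < c.
Hypothesis mw : measurable_fun posR w.
Hypothesis wC : forall t, 0 < t -> `|w t| <= C * expR (- (c * t)).

Lemma Int_mellin x : 0 < x -> Int (fun t => t `^ (x - 1) * w t).
Proof.
move=> x0; apply: (@Int_le _ _ (fun t => C * (t `^ (x - 1) * expR (- (c * t))))).
- exact: measurable_mellin.
- move=> t t0; rewrite normrM ger0_norm ?powR_ge0// mulrCA.
  by apply: ler_wpM2l; [exact: powR_ge0|exact: wC].
- by apply: IntZ; exact: Int_powR_expR.
Qed.

(** A bound uniform in x near a, to dominate the derivative of the integrand. The logarithm is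
    bounded with d = a/4, so the exponents x - 1 - a/4 and x - 1 + a/4 stay between a/4 - 1 and 3a -
    1. Each of the two powers is below the same sum, whence the factor 2/(a/4) = 8/a. *)
Lemma mellin_ln_bound a x t : 0 < a -> a / 2 <= x <= 2 * a -> 0 < t ->
  `|t `^ (x - 1) * ln t * w t| <=
  (C * (8 / a)) * (t `^ (a / 4 - 1) * expR (- (c * t)) + t `^ (3 * a - 1) * expR (- (c * t))).
Proof.
move=> a0 /andP[ax xa] t0; have d0 : 0 < a / 4 by rewrite divr_gt0.
have h := ln_powR_bound d0 t0.
rewrite !normrM (ger0_norm (powR_ge0 _ _)).
have p0 := powR_ge0 t (x - 1).
have h1 : t `^ (x - 1) * `|ln t| <= (t `^ (a / 4 - 1) + t `^ (3 * a - 1)) * (8 / a).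
  apply: (le_trans (ler_wpM2l p0 h)); rewrite mulrA mulrDr.
  have tn : t != 0 by rewrite gt_eqF.
  rewrite -!powRD ?tn ?implybT//.
  have -> : 8 / a = 2 * (a / 4)^-1 by field; rewrite gt_eqF.
  rewrite mulrA; apply: ler_wpM2r; first by rewrite invr_ge0 ltW.
  rewrite mulr_natr mulr2n.
  by apply: lerD; apply: powR_between => //; apply/andP; split; lra.
apply: (le_trans (ler_pM _ _ h1 (wC t0))) => //.
  by rewrite mulr_ge0.
by rewrite le_eqVlt; apply/orP; left; apply/eqP; ring.
Qed.

Let Int_dominator a : 0 < a ->
  Int (fun t => (C * (8 / a)) * (t `^ (a / 4 - 1) * expR (- (c * t)) + t `^ (3 * a - 1) *
    expR (- (c * t)))).
Proof.
move=> a0; apply: IntZ; apply: IntD; apply: Int_powR_expR => //; lra.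
Qed.

Lemma Int_mellin_ln a : 0 < a -> Int (fun t => t `^ (a - 1) * ln t * w t).
Proof.
move=> a0; apply: (Int_le _ _ (Int_dominator a0)).
  exact: measurable_mellin_ln.
by move=> t; apply: mellin_ln_bound => //; apply/andP; split; lra.
Qed.

(** Differentiation under the integral sign on the window ]a/2, 2a[, dominated through
    [mellin_ln_bound]. *)
Lemma is_derive_mellin a : 0 < a ->
  is_derive a 1 (fun x => J (fun t => t `^ (x - 1) * w t))
    (J (fun t => t `^ (a - 1) * ln t * w t)).
Proof.
move=> a0; pose f x t := t `^ (x - 1) * w t.
have der x t : 0 < t -> is_derive x 1 (f ^~ t) (t `^ (x - 1) * ln t * w t).
  move=> t0; have -> : f ^~ t = w t \*: (expR \o (ln t \*: (id - cst 1))).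
    apply/funext => z; rewrite /f /= mulrC; congr (_ * _).
    by rewrite /powR gt_eqF// mulrC.
  have h : is_derive x 1 (expR \o (ln t \*: (id - cst 1))) (expR ((ln t \*:
    (id - cst 1)) x) * (ln t *: (1 - 0))).
    apply: is_derive1_comp.
  have := is_deriveZ (w t) h => /is_derive_eq; apply.
  rewrite /= subr0 /powR gt_eqF//.
  transitivity (w t * (expR (ln t * (x - 1)) * (ln t * 1))); first by [].
  by rewrite mulr1 (mulrC (ln t) (x - 1)); ring.
have dE x t : 0 < t -> partial1of2 f x t = t `^ (x - 1) * ln t * w t.
  by move=> t0; rewrite partial1of2E; have [_ ->] := der x t t0.
(* The absolute value makes the dominator nonnegative at every real t, whatever the sign of C. *)
pose G t := `|(C * (8 / a)) * (t `^ (a / 4 - 1) * expR (- (c * t)) + t `^ (3 * a - 1) * expR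
  (- (c * t)))|.
have Ia : `]a / 2, 2 * a[%classic a by rewrite /= in_itv /=; apply/andP; split; lra.
have If x : `]a / 2, 2 * a[%classic x -> Int (f x).
  by rewrite /= in_itv /= => /andP[ax _]; apply: Int_mellin; lra.
have df x t : `]a / 2, 2 * a[%classic x -> posR t -> derivable (f^~ t) x 1.
  by move=> _ /posRP t0; have [] := der x t t0.
have G0 t : 0 <= G t by exact: normr_ge0.
have IG : Int G.
  have := integrable_norm (Int_dominator a0); exact.
have Gub x t : `]a / 2, 2 * a[%classic x -> posR t -> `|partial1of2 f x t| <= G t.
  rewrite /= in_itv /= => /andP[/ltW h1 /ltW h2] /posRP t0; rewrite dE//.
  by apply: le_trans (ler_norm _); apply: mellin_ln_bound => //; rewrite h1.
have D := @derivable_under_integral R _ _ mu f posR (@measurable_posR R) a _ _ Ia If df G G0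
  IG Gub.
have E := @differentiation_under_integral R _ _ mu f posR (@measurable_posR R) a _ _ Ia If df
  G G0 IG Gub.
split; first exact: D.
rewrite -derive1E E; apply: eq_Rintegral => t; rewrite inE => /posRP t0; exact: dE.
Qed.

End ExponentialDecay.

(** If the integral vanished, f would be zero almost everywhere; being positive throughout, it would
    make the half-line a null set. *)
Lemma Int_gt0 f : pos_continuous f -> (forall t, 0 < t -> 0 < f t) -> Int f -> 0 < J f.
Proof.
move=> cf f0 If; rewrite lt_neqAle Rintegral_ge0 ?andbT; last first.
  by move=> t /posRP /f0 /ltW.
apply/eqP => J0.
have I0 : (\int[mu]_(t in posR) `|(f t)%:E| = 0)%E.
  transitivity (\int[mu]_(t in posR) (f t)%:E)%E.
    apply: eq_integral => t; rewrite inE => /posRP t0.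
    by rewrite gee0_abs// lee_fin ltW// f0.
  by rewrite -[LHS]fineK ?integrable_fin_num//; rewrite -/(J f) -?J0//; exact: measurable_posR.
have [N [mN N0 sN]] := (ae_eq_integral_abs mu (@measurable_posR R) (measurable_int mu If)).1 I0.
have : (mu posR <= mu N)%E.
  apply: le_measure; rewrite ?inE//; first exact: measurable_posR.
  move=> t tp; apply: sN => /= /(_ tp); move: tp => /posRP /f0.
  by rewrite /= lt_neqAle eq_sym => /andP[/eqP h _] [] /h.
by rewrite N0 lebesgue_measure_itv /= ltry.
Qed.

End MellinDerivative.

(** * The Gamma function *)

Section GammaFunction.
Variable R : realType.
Implicit Types (f g w : R -> R) (t x y c p a C : R).

Lemma expRN_bound t : 0 < t -> `|expR (- t)| <= 1 * expR (- (1 * t)).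
Proof. by move=> _; rewrite !mul1r ger0_norm ?expR_ge0. Qed.

Lemma measurable_expRN : measurable_fun posR (fun t => expR (- t)).
Proof.
by apply: pos_continuous_measurable; under eq_fun do rewrite -mulN1r; exact: pos_continuous_expR.
Qed.

Lemma Int_Gamma x : 0 < x -> Int (fun t => t `^ (x - 1) * expR (- t)).
Proof. exact: Int_mellin ltr01 measurable_expRN expRN_bound x. Qed.

Lemma is_derive_Gamma a : 0 < a ->
  is_derive a 1 (@Gamma R) (J (fun t => t `^ (a - 1) * ln t * expR (- t))).
Proof. exact: is_derive_mellin ltr01 measurable_expRN expRN_bound a. Qed.

Lemma pos_continuous_mellin x w : pos_continuous w ->
  pos_continuous (fun t => t `^ (x - 1) * w t).
Proof. by move=> cw; apply: pos_continuousM => //; exact: pos_continuous_powR. Qed.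

Lemma Gamma_gt0 x : 0 < x -> 0 < Gamma x.
Proof.
move=> x0; apply: Int_gt0; last exact: Int_Gamma.
- by apply: pos_continuous_mellin; under eq_fun do rewrite -mulN1r; exact: pos_continuous_expR.
- by move=> t t0; rewrite mulr_gt0 ?powR_gt0 ?expR_gt0.
Qed.

(** The Gamma integral after the linear substitution t -> c t. *)
Lemma integral_powR_expR x c : 0 < x -> 0 < c ->
  J (fun t => t `^ (x - 1) * expR (- (c * t))) = c `^ (- x) * Gamma x.
Proof.
move=> x0 c0; pose G t := t `^ (x - 1) * expR (- t).
have cG : pos_continuous G by apply: pos_continuous_mellin; under eq_fun do rewrite -mulN1r;
  exact: pos_continuous_expR.
have G0 t : 0 < t -> 0 <= G t by move=> t0; rewrite mulr_ge0 ?powR_ge0 ?expR_ge0.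
have -> : Gamma x = c `^ x * J (fun t => t `^ (x - 1) * expR (- (c * t))).
  rewrite -RintegralZl; last 2 first.
  - exact: measurable_posR.
  - exact: Int_powR_expR.
  rewrite /Gamma /Rintegral (ge0_substitution_powR c0 ltr01 cG G0); congr fine.
  apply: eq_integral => t; rewrite inE => /posRP t0; congr (_%:E).
  rewrite subrr powRr0 !mulr1 powRr1 ?ltW// /G powRM ?ltW//.
  by rewrite -(mulr_powRB1 (ltW c0) x0); ring.
by rewrite powRN mulKf// gt_eqF// powR_gt0.
Qed.

(* The integral is also c^(-x) Gamma(x): comparing the derivatives at c = 1 gives the
   functional equation of Gamma without integrating by parts. *)
Lemma is_derive_scaled_integral x : 0 < x ->
  is_derive (1 : R) 1 (fun c => J (fun t => t `^ (x - 1) * expR (- (c * t)))) (- Gamma (x + 1)).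
Proof.
move=> x0; pose f c t := t `^ (x - 1) * expR (- (c * t)).
have der c t : is_derive c 1 (f ^~ t) (- (t `^ (x - 1) * t * expR (- (c * t)))).
  have -> : f ^~ t = t `^ (x - 1) \*: (expR \o ((- t) \*: id)).
    apply/funext => z; transitivity (t `^ (x - 1) * expR (- t * z)); last by [].
    by rewrite /f mulNr (mulrC z).
  have h : is_derive c 1 (expR \o ((- t) \*: id)) (expR (((- t) \*: id) c) * (- t *: 1)).
    exact: is_derive1_comp.
  have := is_deriveZ (t `^ (x - 1)) h => /is_derive_eq; apply.
  transitivity (t `^ (x - 1) * (expR (- t * c) * (- t * 1))); first by [].
  by rewrite mulr1 mulNr (mulrC t c); ring.
have dE c t : partial1of2 f c t = - (t `^ (x - 1) * t * expR (- (c * t))).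
  by rewrite partial1of2E; have [_ ->] := der c t.
have E t : 0 < t -> t `^ (x - 1) * t = t `^ (x + 1 - 1).
  by move=> t0; rewrite mulrC mulr_powRB1 ?ltW// addrK.
have x10 : 0 < x + 1 by rewrite addr_gt0.
(* For c in ]1/2, 2[, e^(-ct) is at most e^(-t/2), which dominates the derivative in c. *)
pose G t := `|t `^ (x + 1 - 1) * expR (- (2^-1 * t))|.
have Ia : `]2^-1, 2%:R[%classic (1 : R) by rewrite /= in_itv /=; apply/andP; split; lra.
have If c : `]2^-1, 2%:R[%classic c -> Int (f c).
  by rewrite /= in_itv /= => /andP[ac _]; apply: Int_powR_expR => //; lra.
have df c t : `]2^-1, 2%:R[%classic c -> posR t -> derivable (f^~ t) c 1.
  by move=> _ _; have [] := der c t.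
have G0 t : 0 <= G t by exact: normr_ge0.
have IG : Int G.
  by have := integrable_norm (@Int_powR_expR _ (x + 1) 2^-1 x10 _); apply; rewrite invr_gt0.
have Gub c t : `]2^-1, 2%:R[%classic c -> posR t -> `|partial1of2 f c t| <= G t.
  rewrite /= in_itv /= => /andP[/ltW h1 _] /posRP t0; rewrite dE// normrN E//.
  rewrite /G !normrM; apply: ler_wpM2l => //.
  by rewrite !ger0_norm ?expR_ge0// ler_expR lerN2 ler_pM2r.
have D := @derivable_under_integral R _ _ mu f posR (@measurable_posR R) 1 _ _ Ia If df G G0
  IG Gub.
have := @differentiation_under_integral R _ _ mu f posR (@measurable_posR R) 1 _ _ Ia If df G
  G0 IG Gub.
move=> D'; split; first exact: D.
rewrite -derive1E D' -[RHS]mulN1r -RintegralZl; last 2 first.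
- exact: measurable_posR.
- exact: Int_Gamma.
apply: eq_Rintegral => t; rewrite inE => /posRP t0.
by rewrite dE E// mul1r mulN1r.
Qed.

Lemma GammaS x : 0 < x -> Gamma (x + 1) = x * Gamma x.
Proof.
move=> x0; have [_ d1] := is_derive_scaled_integral x0.
have [_ d2] : is_derive (1 : R) 1 (fun c : R => Gamma x *: c `^ (- x)) (Gamma x *:
  (- x * 1 `^ (- x - 1))).
  by have := is_deriveZ (Gamma x) (is_derive1_powR (- x) ltr01); exact.
apply: oppr_inj; rewrite -d1.
transitivity (Gamma x * (- x * 1 `^ (- x - 1))); last by rewrite powR1; ring.
(* The closed form c^(-x) Gamma(x) holds for c > 0 only, which suffices near c = 1. *)
rewrite -[RHS]d2; apply: near_eq_derive.
near=> c; rewrite integral_powR_expR// 1?[_ *: _]mulrC//.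
by near: c; exact: lt_nbhsr.
Unshelve. all: by end_near. Qed.

Lemma GammaDn x n : 0 < x -> Gamma (x + n%:R) = pochhammer x n * Gamma x.
Proof.
move=> x0; elim: n => [|n IH]; first by rewrite addr0 /pochhammer big_ord0 mul1r.
rewrite -natr1 addrA GammaS ?ltr_wpDr// IH /pochhammer big_ord_recr /= mulrA.
by congr (_ * _); rewrite mulrC.
Qed.

End GammaFunction.

(** * Integration of power series against t^(p-1) e^(-t) *)

Section PowerSeries.
Variable R : realType.
Implicit Types (w : R -> R) (u v : nat -> R) (t x y c p a C A K rho : R).

Lemma pochhammer0 x : pochhammer x 0 = 1.
Proof. by rewrite /pochhammer big_ord0. Qed.

Lemma pochhammerS x n : pochhammer x n.+1 = pochhammer x n * (x + n%:R).
Proof. by rewrite /pochhammer big_ord_recr. Qed.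

Lemma pochhammerSl x n : pochhammer x n.+1 = x * pochhammer (x + 1) n.
Proof.
rewrite /pochhammer big_ord_recl addr0; congr (_ * _).
by apply: eq_bigr => i _; rewrite /= /bump /= -natr1 -addrA (addrC 1).
Qed.

Lemma pochhammer_gt0 x n : 0 < x -> 0 < pochhammer x n.
Proof. by move=> x0; apply: prodr_gt0 => i _; rewrite ltr_wpDr. Qed.

Lemma normr_pochhammer x n : `|pochhammer x n| <= pochhammer `|x| n.
Proof.
rewrite /pochhammer normr_prod; apply: ler_prod => i _; rewrite normr_ge0 /=.
by apply: (le_trans (ler_normD _ _)); rewrite (ger0_norm (ler0n _ _)).
Qed.

(** Consecutive quotients have ratio (x+n)/(y+n), which tends to 1 and is therefore eventually at
    most rho. *)
Lemma pochhammer_ratio_le x y rho : 0 < x -> 0 < y -> 1 < rho ->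
  exists2 A, 0 < A & forall n, pochhammer x n / pochhammer y n <= A * rho ^+ n.
Proof.
move=> x0 y0 r1; have r0 : 0 < rho by apply: lt_trans r1.
pose q n := pochhammer x n / pochhammer y n.
have q0 n : 0 < q n by rewrite divr_gt0 ?pochhammer_gt0.
have qS n : q n.+1 = q n * ((x + n%:R) / (y + n%:R)).
  by rewrite /q !pochhammerS invfM mulrACA.
(* From n >= x/(rho-1) on, x + n <= rho n <= rho (y+n). *)
pose N := (Num.truncn (x / (rho - 1))).+1.
have HN n : (N <= n)%N -> (x + n%:R) / (y + n%:R) <= rho.
  move=> Nn; rewrite ler_pdivrMr ?ltr_wpDr//.
  have : x / (rho - 1) <= n%:R.
    by apply/ltW/(lt_le_trans (truncnS_gt _)); rewrite ler_nat.
  rewrite ler_pdivrMr ?subr_gt0// => h.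
  have := mulr_gt0 r0 y0; move: h; move: (n%:R) => m; nra.
(* This sum dominates every q n with n <= N; beyond N the induction gains a factor of at most rho
   per step. *)
exists (\sum_(0 <= i < N.+1) q i).
  by rewrite big_nat_recr //= ltr_wpDl// sumr_ge0// => i _; exact: ltW.
have S0 : 0 <= \sum_(0 <= i < N.+1) q i by apply: sumr_ge0 => i _; exact: ltW.
suff H n : q n <= (\sum_(0 <= i < N.+1) q i) * rho ^+ n by [].
elim: n => [|n IH].
  rewrite mulr1 big_nat_recl//= -[leLHS]addr0; apply: lerD => //.
  by apply: sumr_ge0 => i _; exact: ltW.
have [Nn|nN] := leqP N n.
  rewrite qS exprSr [leRHS]mulrA; apply: ler_pM => //.
  - exact: ltW (q0 n).
  - by rewrite divr_ge0// addr_ge0// ltW.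
  - exact: HN.
apply: (@le_trans _ _ (\sum_(0 <= i < N.+1) q i)).
  rewrite (big_cat_nat (n := n.+2)) //=.
  rewrite [X in _ <= X + _]big_nat_recr//=. rewrite addrAC lerDr addr_ge0//;
    by apply: sumr_ge0 => i _; exact: ltW.
rewrite -[leLHS]mulr1; apply: ler_wpM2l => //.
by rewrite exprn_ege1// ltW.
Qed.

Lemma sum_exp_coeff_le x n : 0 <= x -> series (exp_coeff x) n <= expR x.
Proof.
move=> x0; apply: nondecreasing_cvgn_le; last exact: is_cvg_series_exp_coeff.
by apply: nondecreasing_series => k _ _; exact: exp_coeff_ge0.
Qed.

(** * Power series of exponential type *)

Section ExponentialType.
Variables (u : nat -> R) (A K : R).
Hypotheses (A0 : 0 <= A) (K0 : 0 <= K).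
Hypothesis uAK : forall n, `|u n| <= A * K ^+ n / n`!%:R.

(** Comparison with A times the series of e^(K|t|), the source of all convergence and growth bounds
    below. *)
Lemma exp_type_term t n : `|u n * t ^+ n| <= A * exp_coeff (K * `|t|) n.
Proof.
rewrite normrM normrX /exp_coeff /= exprMn.
apply: (le_trans (ler_wpM2r _ (uAK n))); first exact: exprn_ge0.
by rewrite le_eqVlt; apply/orP; left; apply/eqP; ring.
Qed.

Lemma exp_type_normed_cvg t : cvgn [normed [series u n * t ^+ n]_n].
Proof.
apply: (@series_le_cvg _ _ (fun n => A * exp_coeff (K * `|t|) n)) => //.
- by move=> n; exact: normr_ge0.
- by move=> n; rewrite mulr_ge0// exp_coeff_ge0// mulr_ge0.
- exact: exp_type_term.
- exact: (is_cvg_seriesZ (k := A) (is_cvg_series_exp_coeff (K * `|t|))).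
Qed.

Lemma exp_type_cvg t : cvgn (pseries u t).
Proof. by apply: normed_cvg; exact: exp_type_normed_cvg. Qed.

Lemma exp_type_psum_le t n : 0 <= t -> `|pseries u t n| <= A * expR (K * t).
Proof.
move=> t0; apply: (le_trans (ler_norm_sum _ _ _)).
apply: (@le_trans _ _ (A * series (exp_coeff (K * t)) n)); last first.
  by apply: ler_wpM2l => //; apply: sum_exp_coeff_le; rewrite mulr_ge0.
rewrite /series /= mulr_sumr; apply: ler_sum => i _.
by have := exp_type_term t i; rewrite (ger0_norm t0).
Qed.

Lemma exp_type_sum_le t : 0 <= t -> `|limn (pseries u t)| <= A * expR (K * t).
Proof.
move=> t0; have h : `|pseries u t n| @[n --> \oo] --> `|limn (pseries u t)|.
  by apply: cvg_norm; exact: exp_type_cvg.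
rewrite -(cvg_lim _ h)//; apply: limr_le; first by apply/cvg_ex; eexists; exact: h.
by near=> n; exact: exp_type_psum_le.
Unshelve. all: by end_near. Qed.

End ExponentialType.

(** Differentiation keeps the type K and only multiplies the constant A by K, so it can be
    iterated. *)
Lemma exp_type_diffs u A K :
  (forall n, `|u n| <= A * K ^+ n / n`!%:R) ->
  forall n, `|pseries_diffs u n| <= (A * K) * K ^+ n / n`!%:R.
Proof.
move=> uAK n; rewrite /pseries_diffs normrM ger0_norm//.
have := uAK n.+1; rewrite -(ler_pM2l (ltr0Sn R n)) => /le_trans; apply.
rewrite factS natrM exprS le_eqVlt; apply/orP; left; apply/eqP; field.
by rewrite nat1r !pnatr_eq0 -lt0n fact_gt0.
Qed.

(** A power series is differentiable inside a radius at which it and its first two derived series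
    converge; here they converge everywhere, and the radius |t| + 1 serves. *)
Lemma exp_type_continuous u A K : 0 <= A -> 0 <= K ->
  (forall n, `|u n| <= A * K ^+ n / n`!%:R) -> continuous (fun t => limn (pseries u t)).
Proof.
move=> A0 K0 uAK t; have AK0 : 0 <= A * K by exact: mulr_ge0.
have AKK0 : 0 <= A * K * K by exact: mulr_ge0.
have h1 := exp_type_diffs uAK; have h2 := exp_type_diffs h1.
apply: is_derive_continuous; apply: (@pseries_snd_diffs _ _ (`|t| + 1)).
- exact: (exp_type_cvg (A := A) (K := K)).
- exact: (exp_type_cvg (A := A * K) (K := K)).
- exact: (exp_type_cvg (A := A * K * K) (K := K)).
- by rewrite [ltRHS]ger0_norm ?ltrDl// addr_ge0.
Qed.

(** * Termwise integration for type K < 1 *)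

Section Laplace.
Variables (u : nat -> R) (A K : R).
Hypotheses (A0 : 0 <= A) (K0 : 0 <= K) (K1 : K < 1).
Hypothesis uAK : forall n, `|u n| <= A * K ^+ n / n`!%:R.

Definition laplace_weight (t : R) := expR (- t) * limn (pseries u t).

Lemma laplace_weight_pos_continuous : pos_continuous laplace_weight.
Proof.
apply: pos_continuousM; last by move=> t _; exact: exp_type_continuous uAK t.
by under eq_fun do rewrite -mulN1r; exact: pos_continuous_expR.
Qed.

Lemma laplace_weight_bound t : 0 < t -> `|laplace_weight t| <= A * expR (- ((1 - K) * t)).
Proof.
move=> t0; rewrite normrM ger0_norm ?expR_ge0//.
have := exp_type_sum_le A0 K0 uAK (ltW t0) => h.
apply: (le_trans (ler_wpM2l (expR_ge0 _) h)).
by rewrite mulrCA -expRD -mulNr -{1}(mul1r t) -mulNr -mulrDl opprB addrC.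
Qed.

(** Multiplying by t^k raises the exponent p to p + k, so partial sums integrate to finite sums of
    Gamma values. Since K < 1, they are all dominated by A t^(p-1) e^(-(1-K)t), and dominated
    convergence gives the limit. *)
Lemma mellin_series_cvg p : 0 < p ->
  series (fun n => u n * Gamma (p + n%:R)) @ \oo --> J (fun t => t `^ (p - 1) * laplace_weight t).
Proof.
move=> p0; have K10 : 0 < 1 - K by rewrite subr_gt0.
pose f n t := t `^ (p - 1) * (expR (- t) * pseries u t n).
have fE n : f n = fun t => \sum_(0 <= k < n) u k * (t `^ (p - 1) * expR (- t) * t ^+ k).
  by apply/funext => t; rewrite /f /pseries /series /= !mulr_sumr; apply: eq_bigr => k _; ring.
have tE k t : 0 < t -> t `^ (p - 1) * expR (- t) * t ^+ k = t `^ (p + k%:R - 1) * expR (- t).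
  move=> t0; rewrite mulrAC -powR_mulrn ?ltW// -powRD; last by rewrite (gt_eqF t0) implybT.
  by rewrite addrAC.
have Ik k : Int (fun t => t `^ (p - 1) * expR (- t) * t ^+ k).
  apply: (@eq_integrable _ _ _ mu posR (@measurable_posR R) (EFin \o (fun t => t `^ (p + k%:R
    - 1) * expR (- t)))).
  + by move=> t; rewrite inE => /posRP t0 /=; rewrite tE.
  + by apply: Int_Gamma; rewrite ltr_wpDr.
have If n : Int (f n) /\ J (f n) = series (fun n => u n * Gamma (p + n%:R)) n.
  rewrite fE.
  elim: n => [|n [IH1 IH2]].
    rewrite /series /= big_geq//; under eq_fun do rewrite big_geq//.
    split; last by rewrite /Rintegral integral0.
    exact: integrable0.
  rewrite /series /= big_nat_recr//=; under eq_fun do rewrite big_nat_recr//=.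
  split; first by apply: IntD => //; exact: IntZ.
  rewrite RintegralD//=; [|exact: measurable_posR|exact: IntZ].
  rewrite IH2; congr (_ + _); rewrite RintegralZl//; last exact: measurable_posR.
  congr (_ * _); apply: eq_Rintegral => t; rewrite inE => /posRP t0; exact: tE.
have cvgf t : 0 < t -> f n t @[n --> \oo] --> t `^ (p - 1) * laplace_weight t.
  move=> t0; apply: cvgM; first exact: cvg_cst.
  by apply: cvgM; [exact: cvg_cst|exact: (exp_type_cvg A0 K0 uAK)].
have mE : measurable_fun posR (EFin \o (fun t => t `^ (p - 1) * laplace_weight t)).
  apply/measurable_EFinP; apply: pos_continuous_measurable; apply: pos_continuous_mellin;
    exact: laplace_weight_pos_continuous.
have IG : Int (fun t => A * (t `^ (p - 1) * expR (- ((1 - K) * t)))).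
  by apply: IntZ; exact: Int_powR_expR.
have fG t n : 0 < t -> `|f n t| <= A * (t `^ (p - 1) * expR (- ((1 - K) * t))).
  move=> t0; rewrite !normrM ger0_norm ?powR_ge0// [leRHS]mulrCA; apply: ler_wpM2l;
    first exact: powR_ge0.
  rewrite ger0_norm ?expR_ge0//.
  have := exp_type_psum_le A0 K0 uAK n (ltW t0) => h.
  apply: (le_trans (ler_wpM2l (expR_ge0 _) h)).
  by rewrite mulrCA -expRD -mulNr -{1}(mul1r t) -mulNr -mulrDl opprB addrC.
have [|||||Iw _ C] := @dominated_convergence _ _ _ mu posR (@measurable_posR R)
  (fun n t => (f n t)%:E) (fun t => (t `^ (p - 1) * laplace_weight t)%:E)
  (fun t => (A * (t `^ (p - 1) * expR (- ((1 - K) * t))))%:E).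
- by move=> n; exact: measurable_int (If n).1.
- exact: mE.
- by apply: aeW => t /posRP t0; apply: cvg_EFin; [exact: nearW|exact: cvgf].
- exact: IG.
- by apply: aeW => t n /posRP t0; rewrite lee_fin; exact: fG.
have := @fine_cvg _ _ _ _ _ (J (fun t => t `^ (p - 1) * laplace_weight t)).
rewrite /Rintegral fineK; last by apply: integrable_fin_num => //; exact: measurable_posR.
move=> /(_ _ _ _ _ C); apply: cvg_trans; apply: near_eq_cvg; near=> n.
by have [_ <-] := If n.
Unshelve. all: by end_near. Qed.

End Laplace.

End PowerSeries.

(** * Cauchy products and the Chu-Vandermonde identity *)

Section Kummer.
Variable R : realType.
Implicit Types (w : R -> R) (u v : nat -> R) (t x y c p a C A K rho : R).

Definition convolution u v n := \sum_(0 <= k < n.+1) u k * v (n - k)%N.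

(** The triangle k + i < n is summed by rows instead of antidiagonals; [series v m] has the m terms
    of index below m, so row k ends at i = n-k-1. *)
Lemma series_convolution u v n :
  series (convolution u v) n = \sum_(0 <= k < n) u k * series v (n - k)%N.
Proof.
elim: n => [|n IH]; first by rewrite /series /= !big_geq.
rewrite seriesSr /GRing.add /= IH.
transitivity (\sum_(0 <= k < n.+1) (u k * series v (n - k)%N + u k * v (n - k)%N)).
  rewrite big_split /=; congr (_ + _).
  have s00 : series v 0%N = 0 by rewrite /series /= big_geq.
  by rewrite [RHS]big_nat_recr//= subnn s00 mulr0 addr0.
rewrite !big_nat; apply: eq_bigr => k /andP[_ kn].
by rewrite subSn// seriesSr mulrDr.
Qed.

Lemma cvg_half : n./2 @[n --> \oo] --> \oo.
Proof.
move=> P [N _ NP]; exists N.*2 => // n /= Nn; apply: NP => /=.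
by rewrite -(doubleK N) half_leq.
Qed.

(** The triangle k + i < n lies between the squares of side n/2 and n, whose sums both tend to U
    V. *)
Lemma ge0_cauchy_product u v (U V : R) :
  (forall n, 0 <= u n) -> (forall n, 0 <= v n) ->
  series u @ \oo --> U -> series v @ \oo --> V ->
  series (convolution u v) @ \oo --> U * V.
Proof.
move=> u0 v0 cu cv.
have mono m n : (m <= n)%N -> series v m <= series v n.
  by move=> mn; apply: (nondecreasing_series (fun k _ _ => v0 k)).
have s0 n : 0 <= series v n by apply: sumr_ge0.
apply: (@squeeze_cvgr _ _ _ _ (fun n => series u n./2 * series v n./2)
  (fun n => series u n * series v n)).
- apply: nearW => n; rewrite series_convolution; apply/andP; split.
    rewrite [X in X * _]/series /= mulr_suml.
    have h2 : (n./2 <= n)%N by lia.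
    rewrite (big_cat_nat (n := n./2) (p := n))//=.
    rewrite -[leLHS]addr0; apply: lerD; last by apply: sumr_ge0 => i _; exact: mulr_ge0.
    rewrite !big_nat; apply: ler_sum => i /andP[_ ih]; apply: ler_wpM2l => //.
    by apply: mono; rewrite leq_subRL; lia.
  rewrite [X in X * _]/series /= mulr_suml; apply: ler_sum => i _.
  by apply: ler_wpM2l => //; apply: mono; exact: leq_subr.
- apply: cvgM.
    by apply: (cvg_comp (fun n => n./2) (series u)); [exact: cvg_half|exact: cu].
  by apply: (cvg_comp (fun n => n./2) (series v)); [exact: cvg_half|exact: cv].
- exact: cvgM.
Qed.

(** Square minus triangle is, in absolute value, at most the same difference for |u| and |v|, which
    tends to 0 by the nonnegative case. *)
Lemma cauchy_product u v (U V : R) :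
  cvgn [normed series u] -> cvgn [normed series v] ->
  series u @ \oo --> U -> series v @ \oo --> V ->
  series (convolution u v) @ \oo --> U * V.
Proof.
move=> nu nv cu cv.
pose u' n := `|u n|; pose v' n := `|v n|.
have E : series u' n * series v' n - series (convolution u' v') n @[n --> \oo] --> 0.
  rewrite -(subrr (limn (series u') * limn (series v'))); apply: cvgB.
    by apply: cvgM; [exact: nu|exact: nv].
  by apply: ge0_cauchy_product => // n; exact: normr_ge0.
(* The difference collects the pairs k, i < n with k + i >= n. *)
have D u1 v1 n : series u1 n * series v1 n - series (convolution u1 v1) n =
    \sum_(0 <= k < n) u1 k * \sum_(n - k <= i < n) v1 i :> R.
  rewrite series_convolution [X in X * _]/series /= mulr_suml -sumrB.
  by apply: eq_bigr => k _; rewrite -mulrBr sub_series_geq// leq_subr.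
have F : series u n * series v n - series (convolution u v) n @[n --> \oo] --> 0.
  apply/norm_cvg0P; apply: (@squeeze_cvgr _ _ _ _ (cst 0) (fun n => series u' n * series v' n
    - series (convolution u' v') n)) => //; last exact: cvg_cst.
  apply: nearW => n; rewrite normr_ge0 /= !D; apply: (le_trans (ler_norm_sum _ _ _)).
  apply: ler_sum => k _; rewrite normrM; apply: ler_wpM2l => //; exact: ler_norm_sum.
have H : series u n * series v n - (series u n * series v n - series (convolution u v) n)
    @[n --> \oo] --> U * V - 0 by apply: cvgB => //; exact: cvgM.
by move: H; rewrite subr0; under eq_fun do rewrite opprB addrCA subrr addr0.
Qed.

(** The value of 2F1(-n,b;x;1), by induction on n for all b and x, with Pascal's rule. *)
Lemma chu_vandermonde n (b x : R) : 0 < x ->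
  \sum_(0 <= k < n.+1) 'C(n, k)%:R * ((-1) ^+ k * pochhammer b k / pochhammer x k) =
  pochhammer (x - b) n / pochhammer x n.
Proof.
elim: n b x => [|n IH] b x x0.
  by rewrite big_nat1 bin0 !pochhammer0 !mul1r.
have px m : pochhammer x m != 0 by rewrite gt_eqF// pochhammer_gt0.
pose F k : R := (-1) ^+ k * pochhammer b k / pochhammer x k.
have -> : \sum_(0 <= k < n.+2) 'C(n.+1, k)%:R * F k =
   \sum_(0 <= k < n.+1) 'C(n, k)%:R * F k + \sum_(0 <= k < n.+1) 'C(n, k)%:R * F k.+1.
  rewrite big_nat_recl//= bin0 mul1r.
  under eq_bigr do rewrite binS natrD mulrDl.
  rewrite big_split /= addrA; congr (_ + _).
  rewrite [RHS]big_nat_recl//= bin0 mul1r big_nat_recr//= bin_small// mul0r addr0.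
  by [].
rewrite IH//.
have -> : \sum_(0 <= k < n.+1) 'C(n, k)%:R * F k.+1 =
  - (b / x) * (pochhammer (x - b) n / pochhammer (x + 1) n).
  (* Extracting the first Pochhammer factors shifts b and x both by 1, which preserves their
     difference. *)
  have -> : x - b = x + 1 - (b + 1) by ring.
  rewrite -IH ?addr_gt0// mulr_sumr; apply: eq_bigr => k _.
  rewrite /F !(pochhammerSl _ k) exprS invfM; ring.
have y1 : pochhammer (x + 1) n = pochhammer x n * (x + n%:R) / x.
  by rewrite -pochhammerS pochhammerSl mulrC mulKf// gt_eqF.
have xn : x + n%:R != 0 by rewrite gt_eqF// ltr_wpDr.
by rewrite y1 !pochhammerS; field; rewrite px xn gt_eqF.
Qed.

End Kummer.

(** * Hypergeometric series *)

Section Hypergeometric.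
Variable R : realType.
Implicit Types (t x p a b s z : R).

(** The coefficient of t^n in 1F1(b;a;zt). Keeping z in the coefficient gives the series in t a type
    below 1 when |z| < 1. *)
Definition hypcoeff b a z (n : nat) : R :=
  pochhammer b n / pochhammer a n * z ^+ n / n`!%:R.

Lemma exp_type_hypcoeff b a z : b != 0 -> 0 < a -> `|z| < 1 ->
  exists A K, [/\ 0 <= A, 0 <= K, K < 1 &
    forall n, `|hypcoeff b a z n| <= A * K ^+ n / n`!%:R].
Proof.
move=> b0 a0 z1; have z0 := normr_ge0 z; have z10 : 0 < 1 + `|z| by rewrite ltr_pwDl.
(* The ratio rho = 2/(1+|z|) exceeds 1 while K = rho |z| stays below 1. *)
have rho1 : 1 < 2 / (1 + `|z|) by rewrite ltr_pdivlMr// mul1r; lra.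
have b0' : 0 < `|b| by rewrite normr_gt0.
have [A A0 HA] := pochhammer_ratio_le b0' a0 rho1.
exists A, (2 / (1 + `|z|) * `|z|); split.
- exact: ltW.
- by rewrite mulr_ge0// ltW// (lt_trans _ rho1).
- by rewrite mulrAC ltr_pdivrMr// mul1r; lra.
move=> n; rewrite /hypcoeff !normrM !normfV [`|n`!%:R|]ger0_norm// normrX.
apply: ler_wpM2r; first by rewrite invr_ge0.
rewrite exprMn mulrA; apply: ler_wpM2r; first exact: exprn_ge0.
apply: le_trans (HA n); rewrite (ger0_norm (ltW (pochhammer_gt0 _ a0))).
apply: ler_wpM2r; last exact: normr_pochhammer.
by rewrite invr_ge0 ltW// pochhammer_gt0.
Qed.

Lemma pseries_hypcoeff b a z t : limn (pseries (hypcoeff b a z) t) = hyp1F1 b a (z * t).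
Proof.
rewrite /hyp1F1 /pseries; congr (limn (series _)); apply/funext => n /=.
by rewrite /hypcoeff exprMn; ring.
Qed.

Lemma hypcoeff_cvg b a z t : b != 0 -> 0 < a -> `|z| < 1 ->
  cvgn (pseries (hypcoeff b a z) t).
Proof.
by move=> b0 a0 z1; have [A [K [A0 K0 _ H]]] := exp_type_hypcoeff b0 a0 z1;
  exact: (exp_type_cvg A0 K0 H).
Qed.

Definition laplace_1F1 b a z t := expR (- t) * hyp1F1 b a (z * t).

Lemma laplace_1F1E b a z : laplace_1F1 b a z = laplace_weight (hypcoeff b a z).
Proof. by apply/funext => t; rewrite /laplace_1F1 /laplace_weight pseries_hypcoeff. Qed.

Lemma laplace_1F1_pos_continuous b a z : b != 0 -> 0 < a -> `|z| < 1 ->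
  pos_continuous (laplace_1F1 b a z).
Proof.
move=> b0 a0 z1; have [A [K [A0 K0 _ H]]] := exp_type_hypcoeff b0 a0 z1.
by rewrite laplace_1F1E; exact: laplace_weight_pos_continuous H.
Qed.

Lemma laplace_1F1_bound b a z : b != 0 -> 0 < a -> `|z| < 1 -> exists c C,
  0 < c /\ forall t, 0 < t -> `|laplace_1F1 b a z t| <= C * expR (- (c * t)).
Proof.
move=> b0 a0 z1; have [A [K [A0 K0 K1 H]]] := exp_type_hypcoeff b0 a0 z1.
exists (1 - K), A; split; first by rewrite subr_gt0.
by rewrite laplace_1F1E => t; exact: laplace_weight_bound H t.
Qed.

Lemma Int_laplace_1F1 p b a z : 0 < p -> b != 0 -> 0 < a -> `|z| < 1 ->
  Int (fun t => t `^ (p - 1) * laplace_1F1 b a z t).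
Proof.
move=> p0 b0 a0 z1; have [c [C [c0 H]]] := laplace_1F1_bound b0 a0 z1.
by apply: (Int_mellin c0 _ H p0); apply: pos_continuous_measurable;
  exact: laplace_1F1_pos_continuous.
Qed.

(** Termwise integration yields the factors Gamma(p+n) = (p)_n Gamma(p), which supply the missing
    upper parameter p. *)
Lemma hyp2F1_series_mellin p b a z : 0 < p -> b != 0 -> 0 < a -> `|z| < 1 ->
  hyp2F1_series p b a z = J (fun t => t `^ (p - 1) * laplace_1F1 b a z t) / Gamma p.
Proof.
move=> p0 b0 a0 z1; have [A [K [A0 K0 K1 H]]] := exp_type_hypcoeff b0 a0 z1.
have G0 : Gamma p != 0 by rewrite gt_eqF// Gamma_gt0.
have := mellin_series_cvg A0 K0 K1 H p0; rewrite -laplace_1F1E => C.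
apply/cvg_lim => //.
have -> : series (fun n => pochhammer p n * pochhammer b n / pochhammer a n * z ^+ n / n`!%:R) =
    (fun n => series (fun n => hypcoeff b a z n * Gamma (p + n%:R)) n / Gamma p).
  apply/funext => n; rewrite /series /= mulr_suml; apply: eq_bigr => k _.
  by rewrite GammaDn// /hypcoeff mulrA mulfK//; ring.
by apply: cvgM => //; exact: cvg_cst.
Qed.

(** All terms are nonnegative and the first one is 1. *)
Lemma hyp1F1_ge1 b a z t : 0 < b -> 0 < a -> 0 <= z < 1 -> 0 < t -> 1 <= hyp1F1 b a (z * t).
Proof.
move=> b0 a0 /andP[z0 z1] t0; rewrite -pseries_hypcoeff.
have -> : 1 = pseries (hypcoeff b a z) t 1%N.
  by rewrite /pseries /series /= big_nat1 /hypcoeff !pochhammer0 !expr0 fact0 !mulr1 !divr1.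
apply: nondecreasing_cvgn_le; last first.
  by apply: hypcoeff_cvg => //; [rewrite gt_eqF|rewrite ger0_norm].
apply: nondecreasing_series => k _ _.
by rewrite !mulr_ge0 ?invr_ge0 ?exprn_ge0 ?(ltW (pochhammer_gt0 _ _))// ltW.
Qed.

Lemma hyp1F1_diag a x : 0 < a -> hyp1F1 a a x = expR x.
Proof.
move=> a0; rewrite /hyp1F1 /expR; congr (limn (series _)); apply/funext => n.
by rewrite divff ?mul1r// gt_eqF// pochhammer_gt0.
Qed.

(** By symmetry in the upper parameters, the Mellin formula applies with 1F1(a;a;x) = e^x and leaves
    a Gamma integral of rate 1 - z. *)
Lemma hyp2F1_series_binomial a m z : 0 < a -> 0 < m -> 0 <= z < 1 ->
  hyp2F1_series a m a z = (1 - z) `^ (- m).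
Proof.
move=> a0 m0 /andP[z0 z1].
have -> : hyp2F1_series a m a z = hyp2F1_series m a a z.
  rewrite /hyp2F1_series; congr (limn (series _)); apply/funext => n.
  by rewrite (mulrC (pochhammer a n) (pochhammer m n)).
rewrite hyp2F1_series_mellin ?gt_eqF ?ger0_norm//.
have -> : J (fun t => t `^ (m - 1) * laplace_1F1 a a z t) =
  J (fun t => t `^ (m - 1) * expR (- ((1 - z) * t))).
  apply: eq_Rintegral => t _; congr (_ * _).
  by rewrite /laplace_1F1 hyp1F1_diag// -expRD; congr expR; ring.
by rewrite integral_powR_expR ?subr_gt0// mulfK// gt_eqF// Gamma_gt0.
Qed.

(** Kummer's transformation as an inequality: the Cauchy product with e^(wt) has nonnegative terms,
    the first being 1, so the product is at least 1. *)
Lemma hyp1F1_kummer_ge s a (w t : R) : 0 < s -> 0 < a -> 0 <= w < 1 -> 0 < t ->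
  expR (- (w * t)) <= hyp1F1 (- s) a (- w * t).
Proof.
move=> s0 a0 /andP[w0 w1] t0.
have wN : `|- w| < 1 by rewrite normrN ger0_norm.
have sN : - s != 0 by rewrite oppr_eq0 gt_eqF.
pose x := w * t; have x0 : 0 <= x by rewrite mulr_ge0// ltW.
pose u n := hypcoeff (- s) a (- w) n * t ^+ n.
pose v := exp_coeff x.
have [A [K [A0 K0 K1 H]]] := exp_type_hypcoeff sN a0 wN.
have nu : cvgn [normed series u] by exact: (exp_type_normed_cvg A0 K0 H (t := t)).
have nv : cvgn [normed series v] by rewrite normed_series_exp_coeff;
  exact: is_cvg_series_exp_coeff.
have cu : series u @ \oo --> hyp1F1 (- s) a (- w * t).
  by rewrite -pseries_hypcoeff; exact: hypcoeff_cvg.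
have cv : series v @ \oo --> expR x by exact: is_cvg_series_exp_coeff.
have cuv := cauchy_product nu nv cu cv.
(* Writing a + s as a - (-s) brings the convolution to the Chu-Vandermonde form. *)
have uvE n : convolution u v n = pochhammer (a + s) n / pochhammer a n * x ^+ n / n`!%:R.
  rewrite -{1}(opprK s) -chu_vandermonde// /convolution !mulr_suml !big_nat.
  apply: eq_bigr => k /andP[_]; rewrite ltnS => kn.
  have -> : x ^+ n = x ^+ k * x ^+ (n - k) by rewrite -exprD subnKC.
  have f0 i : i`!%:R != 0 :> R by rewrite pnatr_eq0 -lt0n fact_gt0.
  have -> : 'C(n, k)%:R = n`!%:R / (k`!%:R * (n - k)`!%:R) :> R.
    by rewrite -(bin_fact kn) !natrM mulfK// mulf_neq0.
  rewrite /u /v /hypcoeff /exp_coeff /= {1}/x [(- w) ^+ k]exprNn !exprMn.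
  have pa : pochhammer a k != 0 by rewrite gt_eqF// pochhammer_gt0.
  by field; rewrite !f0 pa.
have uv0 n : 0 <= convolution u v n.
  rewrite uvE !mulr_ge0 ?invr_ge0 ?exprn_ge0// ltW// pochhammer_gt0// addr_gt0//.
have : 1 <= hyp1F1 (- s) a (- w * t) * expR x.
  rewrite -(cvg_lim _ cuv)//.
  have -> : 1 = series (convolution u v) 1%N.
    by rewrite /series /= big_nat1 uvE !pochhammer0 expr0 fact0 invr1 !mulr1.
  apply: nondecreasing_cvgn_le; last by apply/cvg_ex; eexists; exact: cuv.
  exact: nondecreasing_series.
by rewrite -ler_pdivrMr ?expR_gt0// mul1r -expRN.
Qed.

Lemma hyp2F1_series_gt0 p b a z : 0 < p -> b != 0 -> 0 < a -> `|z| < 1 ->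
  (forall t, 0 < t -> 0 < hyp1F1 b a (z * t)) -> 0 < hyp2F1_series p b a z.
Proof.
move=> p0 b0 a0 z1 H; rewrite hyp2F1_series_mellin// divr_gt0 ?Gamma_gt0//.
apply: Int_gt0; last exact: Int_laplace_1F1.
- by apply: pos_continuous_mellin; exact: laplace_1F1_pos_continuous.
- by move=> t t0; rewrite !mulr_gt0 ?powR_gt0 ?expR_gt0 ?H.
Qed.

(** The two cases are the branches of [hyp2F1]. In the Pfaff branch the argument becomes w/(1+w), in
    [0,1), and the parameters m, a+s, a are all positive. *)
Lemma hyp2F1_neg_gt0 (m s a w : R) : 0 < m -> 0 < s -> 0 < a -> 0 < w ->
  0 < hyp2F1 m (- s) a (- w).
Proof.
move=> m0 s0 a0 w0; rewrite /hyp2F1 normrN ger0_norm ?ltW//; case: ifPn => w1.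
  apply: hyp2F1_series_gt0 => //; first by rewrite oppr_eq0 gt_eqF.
    by rewrite normrN ger0_norm// ltW.
  move=> t t0; apply: (lt_le_trans (expR_gt0 _)).
  by apply: hyp1F1_kummer_ge => //; rewrite ltW.
have w10 : 0 < 1 + w by rewrite addr_gt0.
rewrite opprK mulr_gt0 ?powR_gt0//.
have wn : - w - 1 != 0 by rewrite lt_eqF//; lra.
have -> : - w / (- w - 1) = w / (1 + w) by field; rewrite wn gt_eqF.
have as0 : 0 < a + s by exact: addr_gt0.
have z0 : 0 <= w / (1 + w) by rewrite divr_ge0 ?ltW.
have z1 : w / (1 + w) < 1 by rewrite ltr_pdivrMr// mul1r ltrDr.
apply: hyp2F1_series_gt0; rewrite ?opprK ?gt_eqF ?ger0_norm//.
by move=> t t0; apply: lt_le_trans (hyp1F1_ge1 _ _ _ _); rewrite ?z0.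
Qed.

End Hypergeometric.

(** * Logarithmic moments and a bound for ln(1+x) *)

Section LogMoment.
Variable R : realType.
Implicit Types (f g w : R -> R) (t x y c p a C : R).

Lemma is_derive_laplace_1F1_mellin (b a z p : R) : 0 < p -> b != 0 -> 0 < a -> `|z| < 1 ->
  is_derive p 1 (fun q => J (fun t => t `^ (q - 1) * laplace_1F1 b a z t))
    (J (fun t => t `^ (p - 1) * ln t * laplace_1F1 b a z t)).
Proof.
move=> p0 b0 a0 z1; have [c [C [c0 H]]] := laplace_1F1_bound b0 a0 z1.
by apply: (is_derive_mellin c0 _ H p0); apply: pos_continuous_measurable;
  exact: laplace_1F1_pos_continuous.
Qed.

Lemma Int_laplace_1F1_ln (b a z p : R) : 0 < p -> b != 0 -> 0 < a -> `|z| < 1 ->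
  Int (fun t => t `^ (p - 1) * ln t * laplace_1F1 b a z t).
Proof.
move=> p0 b0 a0 z1; have [c [C [c0 H]]] := laplace_1F1_bound b0 a0 z1.
by apply: (Int_mellin_ln c0 _ H p0); apply: pos_continuous_measurable;
  exact: laplace_1F1_pos_continuous.
Qed.

(** The quotient rule for 2F1(p,b;a;z) as Mellin transform over Gamma(p), solved for the derivative
    of the transform. *)
Lemma mellin_ln_laplace_1F1 (b a z p : R) : 0 < p -> b != 0 -> 0 < a -> `|z| < 1 ->
  J (fun t => t `^ (p - 1) * ln t * laplace_1F1 b a z t) =
  Gamma p * (hyp2F1_da p b a z + digamma p * hyp2F1_series p b a z).
Proof.
move=> p0 b0 a0 z1; have G0 : Gamma p != 0 by rewrite gt_eqF// Gamma_gt0.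
have d1 := is_derive_laplace_1F1_mellin p0 b0 a0 z1.
have d2 := is_derive_Gamma p0.
have [_ d3] := is_deriveM d1 (is_deriveV G0 d2).
have -> : hyp2F1_da p b a z =
    'D_1 ((fun q => J (fun t => t `^ (q - 1) * laplace_1F1 b a z t)) * (fun q => (Gamma q)^-1)) p.
  (* The Mellin formula needs q > 0, which holds near p. *)
  rewrite /hyp2F1_da derive1E; apply: near_eq_derive.
  near=> q; rewrite /hyp2F1 z1 hyp2F1_series_mellin//.
  by near: q; exact: lt_nbhsr.
rewrite d3 hyp2F1_series_mellin// /digamma derive1E.
have [_ ->] := d2.
have sc (u v : R) : u *: v = u * v by [].
by rewrite scaleNr !sc; field.
Unshelve. all: by end_near. Qed.

(** For x <= 1, ln(1+x) <= x <= x^d. For x > 1, ln(1+x) <= ln(2x) <= 1 + ln x, and d ln x <= x^d - 1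
    with d <= 1 concludes. *)
Lemma ln1D_le (d x : R) : 0 < d <= 1 -> 0 < x -> ln (1 + x) <= x `^ d / d.
Proof.
move=> /andP[d0 d1] x0; have xd0 := powR_gt0 d x0.
have [x1|x1] := leP x 1.
  apply: (@le_trans _ _ x); first by apply: le_ln1Dx; lra.
  apply: (@le_trans _ _ (x `^ d)); first by apply: ger1_powR => //; rewrite x0.
  by rewrite ler_pdivlMr// ler_piMr// ltW.
have h : d * ln x <= x `^ d - 1.
  by rewrite -ln_powR -[X in ln X](subrK 1) addrC; apply: le_ln1Dx; lra.
have h2 : ln (1 + x) <= 1 + ln x.
  apply: (@le_trans _ _ (ln (2 * x))); first by rewrite ler_ln ?posrE; lra.
  rewrite lnM ?posrE//; apply: lerD => //.
  by have -> : (2 : R) = 1 + 1 by []; apply: le_ln1Dx; lra.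
rewrite ler_pdivlMr//; apply: (@le_trans _ _ ((1 + ln x) * d));
  first by apply: ler_wpM2r => //; exact: ltW.
by rewrite mulrDl mul1r mulrC; lra.
Qed.

End LogMoment.

(** * The shadowed channel *)

Section Channel.
Variable R : realType.

Variables (mX mY OX OY alpha : R).
Hypotheses (mX0 : 0 < mX) (mY0 : 0 < mY) (OX0 : 0 < OX) (OY0 : 0 < OY) (al0 : 0 < alpha).

Let beta := betabar mX mY OX OY.
Let s := 2 / alpha.
Let CA := C_alpha mX mY OX OY alpha.
Let W := laplace_1F1 mY mX beta.
Let N := (1 - beta) `^ mY / Gamma mX.
Let D0 : 0 < mY * OX + mX * OY. Proof. by rewrite addr_gt0 ?mulr_gt0. Qed.
Let s0 : 0 < s. Proof. by rewrite divr_gt0. Qed.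
Let mYn : mY != 0. Proof. by rewrite gt_eqF. Qed.

Let beta01 : 0 < beta < 1.
Proof.
rewrite /beta /betabar divr_gt0 ?mulr_gt0//= ltr_pdivrMr// mul1r ltrDr.
by rewrite mulr_gt0.
Qed.

Let betan1 : `|beta| < 1.
Proof. by case/andP: beta01 => b0 b1; rewrite ger0_norm// ltW. Qed.

Let onemB : 1 - beta = mY * OX / (mY * OX + mX * OY).
Proof. by rewrite /beta /betabar; field; rewrite gt_eqF. Qed.

Let B1 : 0 < (1 - beta) `^ mY.
Proof. by rewrite powR_gt0// subr_gt0; case/andP: beta01. Qed.

Let N0 : 0 < N. Proof. by rewrite divr_gt0 ?Gamma_gt0. Qed.

Lemma C_alpha_gt0 : 0 < CA.
Proof.
rewrite powR_gt0// divr_gt0 ?Gamma_gt0// mulr_gt0 ?Gamma_gt0 ?addr_gt0//.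
by apply: hyp2F1_neg_gt0 => //; rewrite divr_gt0 ?mulr_gt0.
Qed.

(** The density of mX r^2 / OX; the constant [N] is the inverse of Gamma(mX) 2F1(mX,mY;mX;beta), by
    the binomial case. *)
Definition density t := N * (t `^ (mX - 1) * W t).

Lemma density_ge0 t : 0 < t -> 0 <= density t.
Proof.
move=> t0; case/andP: beta01 => b0 b1.
have h : 1 <= hyp1F1 mY mX (beta * t) by apply: hyp1F1_ge1 => //; rewrite (ltW b0).
apply: mulr_ge0; first exact: ltW.
apply: mulr_ge0; first exact: powR_ge0.
by apply: mulr_ge0; [exact: expR_ge0|exact: le_trans h].
Qed.

Lemma density_pos_continuous : pos_continuous density.
Proof. by apply: pos_continuousM; [exact: pos_continuous_cst|apply: pos_continuous_mellin;
  exact: laplace_1F1_pos_continuous]. Qed.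

Lemma Int_density : Int density.
Proof. by apply: IntZ; exact: Int_laplace_1F1. Qed.

Lemma integral_density : J density = 1.
Proof.
case/andP: beta01 => b0 b1.
have G0 : Gamma mX != 0 by rewrite gt_eqF// Gamma_gt0.
rewrite /density RintegralZl; [|exact: measurable_posR|exact: Int_laplace_1F1].
have := hyp2F1_series_mellin mX0 mYn mX0 betan1; rewrite hyp2F1_series_binomial ?(ltW b0)//.
move=> /(congr1 (fun x => x * Gamma mX)) /=; rewrite divfK// => <-.
by rewrite /N powRN; field; rewrite G0 gt_eqF.
Qed.

Lemma Int_ln_density : Int (fun t => ln t * density t).
Proof.
have E t : ln t * density t = N * (t `^ (mX - 1) * ln t * W t) by rewrite /density; ring.
by under eq_fun do rewrite E; apply: IntZ; exact: Int_laplace_1F1_ln.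
Qed.

Lemma integral_ln_density :
  J (fun t => ln t * density t) = digamma mX + (1 - beta) `^ mY * hyp2F1_da mX mY mX beta.
Proof.
case/andP: beta01 => b0 b1.
have G0 : Gamma mX != 0 by rewrite gt_eqF// Gamma_gt0.
have E t : ln t * density t = N * (t `^ (mX - 1) * ln t * W t) by rewrite /density; ring.
under eq_Rintegral do rewrite E.
rewrite RintegralZl; [|exact: measurable_posR|exact: Int_laplace_1F1_ln].
rewrite mellin_ln_laplace_1F1// hyp2F1_series_binomial ?(ltW b0)// powRN /N.
by field; rewrite G0 gt_eqF.
Qed.

(** * Change of variables from the envelope to t *)

Let c := mX / OX.
Let c0 : 0 < c. Proof. by rewrite divr_gt0. Qed.

(** The right-hand side has the exact shape of the substitution t = c r^2, Jacobian included, hence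
    the real exponents 2 and 2 - 1. *)
Lemma BX_pdf_density r : 0 < r ->
  BX_pdf mX mY OX OY r = density (c * r `^ 2) * (c * 2 * r `^ (2 - 1)).
Proof.
move=> r0; have r20 : 0 <= r `^ 2 by exact: powR_ge0.
have r2E : r `^ 2 = r ^+ 2 by rewrite powR_mulrn// ltW.
rewrite /BX_pdf /density /N /W /laplace_1F1 -/c -onemB r2E.
have -> : mX ^+ 2 * OY * r ^+ 2 / (OX * (mY * OX + mX * OY)) = beta * (c * r ^+ 2).
  by rewrite /beta /betabar /c; field; rewrite !gt_eqF.
have -> : 2 - 1 = 1 :> R by ring.
rewrite powRr1 ?ltW// powRM ?exprn_ge0 ?ltW//.
rewrite -(mulr_powRB1 (ltW c0) mX0) -r2E -powRrM.
have -> : r `^ (2 * mX - 1) = r `^ (2 * (mX - 1)) * r.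
  rewrite -{3}(powRr1 (ltW r0)) -powRD; last by rewrite (gt_eqF r0) implybT.
  by congr (_ `^ _); ring.
by ring.
Qed.

Lemma snrE g r : 0 < r -> snr mX mY OX OY alpha g r = g * (CA * (c * r `^ 2)) `^ s.
Proof.
move=> r0; rewrite /snr -/CA -/s powR_mulrn ?ltW//; congr (_ * _ `^ _).
by rewrite /c; field; rewrite gt_eqF.
Qed.

(** With y the SNR, log2(1+y) = log2 y + log2(1+1/y): [H] will integrate to [A_approx], and [Gap] is
    the error. *)
Let H g t := log2 (g * (CA * t) `^ s) * density t.
Let Gap g t := log2 (1 + (g * (CA * t) `^ s)^-1) * density t.

Lemma log2_snr g t : 0 < g -> 0 < t ->
  log2 (g * (CA * t) `^ s) = (ln g + s * ln CA) / ln 2 + s / ln 2 * ln t.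
Proof.
move=> g0 t0; have C0 := C_alpha_gt0.
rewrite /log2 lnM ?posrE ?powR_gt0 ?mulr_gt0// ln_powR lnM ?posrE//; ring.
Qed.

Lemma pos_continuous_eq (f1 f2 : R -> R) : (forall t, 0 < t -> f1 t = f2 t) ->
  pos_continuous f1 -> pos_continuous f2.
Proof.
move=> E cf t t0; have h := cf t t0.
rewrite /prop_for /continuous_at -(E _ t0); apply: cvg_trans h; apply: near_eq_cvg.
by near=> u; rewrite E//; near: u; exact: lt_nbhsr.
Unshelve. all: by end_near. Qed.

Let HE g t : 0 < g -> 0 < t ->
  H g t = (ln g + s * ln CA) / ln 2 * density t + s / ln 2 * (ln t * density t).
Proof. by move=> g0 t0; rewrite /H log2_snr//; ring. Qed.

Let H_pos_continuous g : 0 < g -> pos_continuous (H g).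
Proof.
move=> g0; apply: (@pos_continuous_eq (fun t => (ln g + s * ln CA) / ln 2 * density t + s /
  ln 2 * (ln t * density t))).
  by move=> t t0; rewrite HE.
apply: pos_continuousD; apply: pos_continuousM;
  [exact: pos_continuous_cst|exact: density_pos_continuous|exact: pos_continuous_cst|].
by apply: pos_continuousM; [exact: (@pos_continuous_ln R)|exact: density_pos_continuous].
Qed.

Let Int_H g : 0 < g -> Int (H g).
Proof.
move=> g0.
apply: (@Int_eq _ (fun t => (ln g + s * ln CA) / ln 2 * density t + s / ln 2 * (ln t *
  density t))).
  by move=> t t0; rewrite HE.
by apply: IntD; apply: IntZ; [exact: Int_density|exact: Int_ln_density].
Qed.

Let J_H g : 0 < g -> J (H g) = A_approx mX mY OX OY alpha g.
Proof.
move=> g0; have C0 := C_alpha_gt0.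
transitivity (J (fun t => (ln g + s * ln CA) / ln 2 * density t + s / ln 2 * (ln t * density t))).
  by apply: eq_Rintegral => t; rewrite inE => /posRP t0; exact: HE.
rewrite RintegralD; [|exact: measurable_posR|apply: IntZ; exact: Int_density|apply: IntZ;
  exact: Int_ln_density].
rewrite RintegralZl; [|exact: measurable_posR|exact: Int_density].
rewrite integral_density RintegralZl; [|exact: measurable_posR|exact: Int_ln_density].
rewrite integral_ln_density /A_approx -/CA -/beta.
rewrite [ln (CA * _)]lnM ?posrE ?C0 ?powR_gt0// ln_powR /s.
have l2 : ln 2 != 0 :> R by rewrite gt_eqF// ln_gt0// ltr1n.
by field; rewrite l2 gt_eqF.
Qed.

Let integral_H (F : R -> R) : pos_continuous F ->
  (\int[mu]_(r in posR) (F (c * r `^ 2) * (c * 2 * r `^ (2 - 1)))%:E =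
   \int[mu]_(t in posR) (F t)%:E)%E.
Proof. by move=> cF; rewrite (substitution_powR c0 (ltr0Sn _ 1) cF). Qed.

Lemma E_log2_snr_eq g : 0 < g ->
  E_log2_snr mX mY OX OY alpha g = (A_approx mX mY OX OY alpha g)%:E.
Proof.
move=> g0; rewrite -J_H// /Rintegral fineK; last first.
  by apply: integrable_fin_num; [exact: measurable_posR|exact: Int_H].
rewrite -integral_H; last exact: H_pos_continuous.
apply: eq_integral => r; rewrite inE => /posRP r0; congr (_%:E).
by rewrite snrE// BX_pdf_density// /H mulrA.
Qed.

(** * Decay of the capacity gap *)

Let d := Num.min 1 (mX / (2 * s)).

Let d01 : 0 < d <= 1.
Proof.
rewrite /d; apply/andP; split; last by rewrite ge_min lexx.
by rewrite lt_min ltr01 /= divr_gt0// mulr_gt0.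
Qed.

(** The bound mX/(2s) in [d] keeps s d at most mX/2, so the moment of order -s d is finite; the
    bound 1 is what [ln1D_le] asks. *)
Let sd : 0 < mX - s * d.
Proof.
have : s * d <= mX / 2.
  have -> : mX / 2 = s * (mX / (2 * s)) by field; rewrite gt_eqF.
  by rewrite ler_pM2l// /d ge_min lexx orbT.
by have := mX0; lra.
Qed.

Let K := CA `^ (- (s * d)) / d / ln 2 * N.
Let T t := t `^ (mX - s * d - 1) * W t.

Let ln2_gt0 : 0 < ln 2 :> R. Proof. by rewrite ln_gt0// ltr1n. Qed.

Let Gap_ge0 g t : 0 < g -> 0 < t -> 0 <= Gap g t.
Proof.
move=> g0 t0; apply: mulr_ge0; last exact: density_ge0.
apply: divr_ge0; last exact: ltW.
by rewrite ln_ge0// lerDl invr_ge0 mulr_ge0 ?powR_ge0// ltW.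
Qed.

(** [ln1D_le] at x = 1/SNR separates the factor g^(-d) from a function of t alone; [K] gathers the
    constants. *)
Let Gap_le g t : 0 < g -> 0 < t -> Gap g t <= g `^ (- d) * (K * T t).
Proof.
move=> g0 t0; have C0 := C_alpha_gt0; have /andP[d0 d1] := d01.
have Ct : 0 < CA * t by exact: mulr_gt0.
have y0 : 0 < g * (CA * t) `^ s by rewrite mulr_gt0 ?powR_gt0.
have dt0 := density_ge0 t0.
apply: (@le_trans _ _ (((g * (CA * t) `^ s)^-1 `^ d / d) / ln 2 * density t)).
  apply: ler_wpM2r => //; apply: ler_wpM2r; first by rewrite invr_ge0 ltW.
  by apply: ln1D_le => //; rewrite invr_gt0.
have -> : (g * (CA * t) `^ s)^-1 `^ d = g `^ (- d) * (CA * t) `^ (- (s * d)).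
  rewrite -powR_inv1 ?(ltW y0)// -[LHS]powRrM mulN1r [LHS]powRM ?(ltW g0) ?powR_ge0//.
  by rewrite -[X in _ * X]powRrM mulrN.
rewrite powRM ?(ltW C0) ?(ltW t0)// /density /T.
have -> : t `^ (mX - s * d - 1) = t `^ (- (s * d)) * t `^ (mX - 1).
  by rewrite -powRD; [congr (_ `^ _); ring|rewrite (gt_eqF t0) implybT].
by rewrite le_eqVlt; apply/orP; left; apply/eqP; rewrite /K; ring.
Qed.

Let Gap_pos_continuous g : 0 < g -> pos_continuous (Gap g).
Proof.
move=> g0; have C0 := C_alpha_gt0; apply: pos_continuousM; last exact: density_pos_continuous.
have pp t : 0 < t -> 0 < g * (CA * t) `^ s.
  by move=> t0; rewrite mulr_gt0 ?powR_gt0 ?mulr_gt0.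
have cp : pos_continuous (fun t => g * (CA * t) `^ s).
  apply: pos_continuousM; first exact: pos_continuous_cst.
  apply: (@pos_continuous_comp _ (fun t => CA * t) (fun u => u `^ s)).
  - by move=> u u0; exact: mulr_gt0.
  - by apply: pos_continuousM; [exact: pos_continuous_cst|move=> u _; exact: cvg_id].
  - exact: pos_continuous_powR.
apply: pos_continuousM; last exact: pos_continuous_cst.
apply: (@pos_continuous_comp _ (fun t => 1 + (g * (CA * t) `^ s)^-1) (@ln R)).
- by move=> t t0; rewrite addr_gt0// invr_gt0 pp.
- apply: pos_continuousD; first exact: pos_continuous_cst.
  by move=> t t0; apply: cvgV; [rewrite gt_eqF// pp|exact: cp].
- exact: pos_continuous_ln.
Qed.

Let Int_tail : Int T. Proof. exact: Int_laplace_1F1. Qed.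

Let Int_Gap g : 0 < g -> Int (Gap g).
Proof.
move=> g0; apply: (@Int_le _ _ (fun t => g `^ (- d) * (K * T t))).
- by apply: pos_continuous_measurable; exact: Gap_pos_continuous.
- by move=> t t0; rewrite ger0_norm ?Gap_ge0// Gap_le.
- by apply: IntZ; apply: IntZ.
Qed.

Lemma ergodic_capacity_eq g : 0 < g ->
  (ergodic_capacity mX mY OX OY alpha g - (A_approx mX mY OX OY alpha g)%:E =
   (J (Gap g))%:E)%E.
Proof.
move=> g0; have C0 := C_alpha_gt0.
have -> : ergodic_capacity mX mY OX OY alpha g = (J (fun t => H g t + Gap g t)%R)%:E.
  rewrite /Rintegral fineK; last first.
    apply: integrable_fin_num; first exact: measurable_posR.
    by apply: IntD; [exact: Int_H|exact: Int_Gap].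
  rewrite -integral_H; last by apply: pos_continuousD;
    [exact: H_pos_continuous|exact: Gap_pos_continuous].
  apply: eq_integral => r; rewrite inE => /posRP r0; congr (_%:E).
  rewrite snrE// BX_pdf_density// /H /Gap -mulrDl mulrA; congr (_ * _ * _).
  have y0 : 0 < g * (CA * (c * r `^ 2)) `^ s by exact:
    (mulr_gt0 g0 (powR_gt0 _ (mulr_gt0 C0 (mulr_gt0 c0 (powR_gt0 _ r0))))).
  move: y0; set y := g * _ => y0; rewrite /log2 -mulrDl; congr (_ / _).
  (* The identity used is y (1 + 1/y) = 1 + y. *)
  rewrite -lnM ?posrE ?addr_gt0 ?invr_gt0//; congr ln.
  by rewrite mulrDr mulr1 mulfV ?gt_eqF// addrC.
rewrite RintegralD; [|exact: measurable_posR|exact: Int_H|exact: Int_Gap].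
by rewrite J_H// -EFinB addrAC subrr add0r.
Qed.

Let powRN_cvg0 : g `^ (- d) @[g --> +oo] --> 0.
Proof.
have /andP[d0 d1] := d01.
under eq_fun do rewrite powRN.
apply/(gtr0_cvgV0 (f := fun g => g `^ d)).
  by near=> g; rewrite powR_gt0//; near: g; exact: nbhs_pinfty_gt.
apply/cvgryPge => M; near=> g.
(* Replacing M by max(M, 0) gives a nonnegative base, so that g >= max(M, 0)^(1/d) can be raised to
   the power d. *)
have M0 : 0 <= Num.max M 0 by rewrite le_max lexx orbT.
have gM : (Num.max M 0) `^ d^-1 <= g by near: g; exact: nbhs_pinfty_ge.
apply: (@le_trans _ _ (Num.max M 0)); first by rewrite le_max lexx.
have -> : Num.max M 0 = ((Num.max M 0) `^ d^-1) `^ d.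
  by rewrite -powRrM mulVf ?gt_eqF// powRr1.
apply: ge0_ler_powR => //; rewrite ?nnegrE ?powR_ge0 ?ltW//.
Unshelve. all: by end_near. Qed.

Lemma ergodic_capacity_cvg :
  ((ergodic_capacity mX mY OX OY alpha g - (A_approx mX mY OX OY alpha g)%:E)%E
     @[g --> +oo] --> 0%E).
Proof.
have JH : J (Gap g) @[g --> +oo] --> 0.
  (* Integrating [Gap_le] bounds the gap by g^(-d) times a constant. *)
  apply: (@squeeze_cvgr _ _ _ _ (cst 0) (fun g => g `^ (- d) * (K * J T))).
  - near=> g; have g0 : 0 < g by near: g; exact: nbhs_pinfty_gt.
    apply/andP; split.
      by apply: Rintegral_ge0 => t /posRP t0; exact: Gap_ge0.
    rewrite -RintegralZl; [|exact: measurable_posR|exact: Int_tail].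
    rewrite -RintegralZl; [|exact: measurable_posR|exact: IntZ].
    apply: le_Rintegral; [exact: measurable_posR|exact: Int_Gap|by apply: IntZ; exact: IntZ|].
    by move=> t /posRP t0; exact: Gap_le.
  - exact: cvg_cst.
  - by rewrite -(mul0r (K * J T)); apply: cvgM; [exact: powRN_cvg0|exact: cvg_cst].
have E : (J (Gap g))%:E @[g --> +oo] --> 0%E by apply: cvg_EFin; [exact: nearW|exact: JH].
apply: cvg_trans E; apply: near_eq_cvg; near=> g.
by rewrite ergodic_capacity_eq//; near: g; exact: nbhs_pinfty_gt.
Unshelve. all: by end_near. Qed.

End Channel.

Unset Implicit Arguments.

Theorem theorem4 (R : realType) (mX mY OX OY alpha : R) :
  0 < mX -> 0 < mY -> 0 < OX -> 0 < OY -> 0 < alpha ->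
  (forall gbar : R, 0 < gbar ->
     E_log2_snr mX mY OX OY alpha gbar = (A_approx mX mY OX OY alpha gbar)%:E) /\
  ((ergodic_capacity mX mY OX OY alpha gbar - (A_approx mX mY OX OY alpha gbar)%:E)%E
     @[gbar --> +oo] --> 0%E).
Proof.
move=> mX0 mY0 OX0 OY0 al0; split; last exact: ergodic_capacity_cvg.
by move=> g g0; exact: E_log2_snr_eq.
Qed.
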